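(* Assume the Exponential Time Hypothesis. Then the upper bound $O(\alpha(k,n)\cdot n)$ in the following statement cannot be improved to $\alpha(k,n)^{o(1)}\cdot n^{O(1)}$: ''for every vertex subset problem $\Pi$ and every solution-preserving DP-core $\texttt{D}$ of table complexity $\alpha(k,n)$ solving $\Pi$, and for each $n$-vertex graph $G$ of treewidth $k$, the extension complexity of $P_\Pi(G)$ is at most $O(\alpha(k,n)\cdot n)$.''
   Context: Graphs are triples $G=(V_G,E_G,\rho_G)$ with $V_G,E_G$ finite subsets of $\mathbb{N}$ and $\rho_G\subseteq E_G\times V_G$ an incidence relation; isomorphisms are pairs of bijections on vertices and edges preserving incidence. A vertex subset problem is a set $\Pi$ of pairs $(G,X)$ with $X\subseteq V_G$ finite, closed under isomorphism (if $(G,X)\in\Pi$ and $\phi=(\phi_1,\phi_2)$ is an isomorphism $G\to H$ then $(H,\phi_1(X))\in\Pi$). $\mathrm{Sol}_\Pi(G)=\{X:(G,X)\in\Pi\}$ and $P_\Pi(G)$ is the convex hull of the indicator vectors in $\{0,1\}^{V_G}$ of the sets in $\mathrm{Sol}_\Pi(G)$. The extension complexity of a polytope $P$ is the minimum number of inequalities describing a polytope of which $P$ is a linear projection. Tree decompositions: a nice edge-introducing tree decomposition of $G$ is $\mathcal{T}=(T,B,\xi)$ with $T$ a rooted tree with ordered children, $\xi:E_G\to N(T)$ injective, $B:N(T)\to\mathcal{P}(V_G)$, satisfying the usual tree-decomposition axioms (every vertex in some bag, $\mathrm{endpts}(e)\subseteq B(\xi(e))$, bags containing a vertex form a connected subtree),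 with every node having at most two children, empty bags at leaves and root, join nodes having identical bags to both children, and each single-child node $u$ with child $u'$ being an introduce-vertex node ($B(u)\setminus B(u')=\{v\}$), forget-vertex node ($B(u')\setminus B(u)=\{v\}$) or introduce-edge node ($B(u)=B(u')$, $\xi(e)=u$). Width is $\max|B(u)|-1$; treewidth is the minimum width. $\nu(v)$ is the child of the unique node where $v$ is forgotten. A DP-core $\texttt{D}$ consists of a finite nonempty $\mathrm{Leaf}\subseteq\{0,1\}^*$, maps $\mathrm{IntroVertex}(v,w)$, $\mathrm{IntroEdge}(v,v',w)$, $\mathrm{ForgetVertex}(v,w)$, $\mathrm{Join}(w,w')$ into finite subsets of $\{0,1\}^*$ (extended to sets by union), and $\mathrm{Final}:\{0,1\}^*\to\{0,1\}$. On $\mathcal{T}$ it computes $\Gamma(u)$ bottom-up ($\mathrm{Leaf}$ at leaves, the corresponding map applied to the child's set(s) at other nodes, with $\{v,v'\}=\mathrm{endpts}(e)$ at introduce-edge nodes) and accepts if some $w\in\Gamma(\text{root})$ has $\mathrm{Final}(w)=1$. It solves $\Pi$ if it accepts every tree decomposition of $G$ iff $\mathrm{Sol}_\Pi(G)\ne\emptyset$; it has table complexity $\alpha(k,n)$ if $|\Gamma(u)|\le\alpha(k,n)$ for every node of every width-$\le k$ decomposition of every $n$-vertex graph. A witness tree is a map $W:N(T)\to\{0,1\}^*$ choosing at each node an element consistent with the same rules applied to the chosen strings of the children, with $\mathrm{Final}(W(\text{root}))=1$. $\texttt{D}$ is solution-preserving if there is $\mu:\mathbb{N}\times\{0,1\}^*\to\{0,1\}$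 such that for every $G$ and every tree decomposition $\mathcal{T}$ accepted by $\texttt{D}$, the sets $\{v\in V_G:\mu(v,W(\nu(v)))=1\}$, over all witness trees $W$, are solutions, and every solution arises this way. The Exponential Time Hypothesis (ETH) asserts that 3-SAT cannot be solved in time $2^{o(n)}$ on $n$-variable instances. *)

(* Defs.v *)
From HB Require Import structures.
From mathcomp Require Import all_boot all_order all_algebra finmap.
From mathcomp Require Import all_classical all_reals all_analysis.

Set Implicit Arguments.
Unset Strict Implicit.
Unset Printing Implicit Defensive.

Import Order.TTheory GRing.Theory Num.Theory.
Import numFieldNormedType.Exports.

Local Open Scope fset_scope.

Definition endpts_of (inc : {fset nat * nat}) (V : {fset nat}) (e : nat) :
    {fset nat} := [fset v in V | (e, v) \in inc].

(* Edges have the form [endpts e = {v, v'}]; parallel edges are allowed, and so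
   are loops (the case [v = v']). *)
Record graph := Graph {
  gV : {fset nat};
  gE : {fset nat};
  ginc : {fset nat * nat};
  ginc_sub : ginc `<=` gE `*` gV;
  ginc_endpts :
    forall e, e \in gE -> exists v v', endpts_of ginc gV e = [fset v; v']
}.

Definition endpts (G : graph) (e : nat) : {fset nat} :=
  endpts_of (ginc G) (gV G) e.

Record graph_iso (G H : graph) (f1 f2 : nat -> nat) : Prop := GraphIso {
  iso_V_inj : {in gV G &, injective f1};
  iso_V_im : [fset f1 v | v in gV G] = gV H;
  iso_E_inj : {in gE G &, injective f2};
  iso_E_im : [fset f2 e | e in gE G] = gE H;
  iso_inc : forall e v, e \in gE G -> v \in gV G ->
    ((f2 e, f1 v) \in ginc H) = ((e, v) \in ginc G)
}.

Record vertex_subset_problem := VertexSubsetProblem {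
  vsp : set (graph * {fset nat});
  vsp_sub : forall G X, vsp (G, X) -> X `<=` gV G;
  vsp_iso : forall G H f1 f2 X, graph_iso G H f1 f2 ->
    vsp (G, X) -> vsp (H, [fset f1 v | v in X])
}.

Definition Sol (Pi : vertex_subset_problem) (G : graph) : set {fset nat} :=
  [set X | vsp Pi (G, X)].

Section Polytopes.
Variable R : realType.
Local Open Scope ring_scope.
Local Open Scope classical_set_scope.

Definition convex_hull (E : lmodType R) (S : set E) : set E :=
  [set x | exists (m : nat) (l : 'I_m -> R) (p : 'I_m -> E),
     [/\ forall i, 0 <= l i, \sum_i l i = 1, forall i, S (p i)
       & x = \sum_i l i *: p i]].

Definition polyhedron (d r : nat) (A : 'M[R]_(r, d)) (b : 'cV[R]_r) :
    set 'cV[R]_d :=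
  [set y | forall i, (A *m y) i 0 <= b i 0].

Definition bounded_coords (d : nat) (Q : set 'cV[R]_d) : Prop :=
  exists M : R, forall y, Q y -> forall j, `|y j 0| <= M.

Definition has_extension (E : lmodType R) (P : set E) (r : nat) : Prop :=
  exists (d : nat) (A : 'M[R]_(r, d)) (b : 'cV[R]_r)
         (f : {linear 'cV[R]_d -> E}),
    bounded_coords (polyhedron A b) /\ f @` polyhedron A b = P.

(* An infimum of natural numbers, hence a minimum (+oo if there is none). *)
Definition extension_complexity (E : lmodType R) (P : set E) : \bar R :=
  ereal_inf [set (r%:R)%:E | r in [set r | has_extension P r]].

Definition indicator (V X : {fset nat}) : {ffun V -> R^o} :=
  [ffun v : V => (val v \in X)%:R].

Definition solution_polytope (Pi : vertex_subset_problem) (G : graph) :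
    set {ffun gV G -> R^o} :=
  convex_hull [set indicator (gV G) X | X in Sol Pi G].

End Polytopes.

(* Rooted trees with ordered children, at most two per node. Nodes are
   addresses: the root is [::], and the first and second child of u are
   [rcons u false] and [rcons u true]. *)
Inductive tree := TLeaf | TOne of tree | TTwo of tree & tree.

Definition node := seq bool.

Fixpoint nodes (t : tree) : seq node :=
  match t with
  | TLeaf => [:: [::]]
  | TOne t1 => [::] :: map (cons false) (nodes t1)
  | TTwo t1 t2 =>
      [::] :: map (cons false) (nodes t1) ++ map (cons true) (nodes t2)
  end.

(* Only meaningful for u \in nodes t. *)
Fixpoint subtree (t : tree) (u : node) : tree :=
  match u, t with
  | [::], _ => t
  | false :: u', TOne t1 => subtree t1 u'
  | false :: u', TTwo t1 _ => subtree t1 u'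
  | true :: u', TTwo _ t2 => subtree t2 u'
  | _, _ => TLeaf
  end.

Definition child0 (u : node) : node := rcons u false.
Definition child1 (u : node) : node := rcons u true.

Definition tree_adj (u w : node) : bool :=
  [|| w == child0 u, w == child1 u, u == child0 w | u == child1 w].

Section NodeKinds.
Variables (G : graph) (B : node -> {fset nat}) (xi : nat -> node).

Definition intro_vertex_node (u : node) (v : nat) : Prop :=
  B (child0 u) `<=` B u /\ B u `\` B (child0 u) = [fset v].

Definition forget_vertex_node (u : node) (v : nat) : bool :=
  (B u `<=` B (child0 u)) && (B (child0 u) `\` B u == [fset v]).

Definition intro_edge_node (u : node) (e : nat) : Prop :=
  [/\ B u = B (child0 u), e \in gE G & xi e = u].

End NodeKinds.

(* Nice edge-introducing tree decompositions. The maps td_bag and td_xi matter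
   only on the nodes of td_tree and on the edges of G, respectively. *)
Record nice_td (G : graph) := NiceTD {
  td_tree : tree;
  td_bag : node -> {fset nat};
  td_xi : nat -> node;
  td_bag_sub : forall u, u \in nodes td_tree -> td_bag u `<=` gV G;
  td_cover : forall v, v \in gV G ->
    exists2 u, u \in nodes td_tree & v \in td_bag u;
  td_connected : forall v u w,
    u \in nodes td_tree -> w \in nodes td_tree ->
    v \in td_bag u -> v \in td_bag w ->
    exists p : seq node,
      [/\ path tree_adj u p, last u p = w
        & forall x, x \in p -> x \in nodes td_tree /\ v \in td_bag x];
  td_xi_inj : {in gE G &, injective td_xi};
  td_xi_node : forall e, e \in gE G -> td_xi e \in nodes td_tree;
  td_xi_endpts : forall e, e \in gE G -> endpts G e `<=` td_bag (td_xi e);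
  td_xi_intro : forall e, e \in gE G ->
    if subtree td_tree (td_xi e) is TOne _
    then intro_edge_node G td_bag td_xi (td_xi e) e else False;
  td_root : td_bag [::] = fset0;
  td_nodes : forall u, u \in nodes td_tree ->
    match subtree td_tree u with
    | TLeaf => td_bag u = fset0
    | TOne _ =>
        [\/ exists v, intro_vertex_node td_bag u v,
            exists v, forget_vertex_node td_bag u v
          | exists e, intro_edge_node G td_bag td_xi u e]
    | TTwo _ _ =>
        td_bag u = td_bag (child0 u) /\ td_bag u = td_bag (child1 u)
    end
}.

Section Decompositions.
Variable G : graph.
Implicit Type T : nice_td G.

Definition td_nodes_of T : seq node := nodes (td_tree T).

(* The width of a decomposition with only empty bags is -1. *)
Definition width T : int :=
  ((\max_(u <- td_nodes_of T) #|` td_bag T u|)%N%:Z - 1)%R.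

(* The first element of the one-element list of children of nodes that forget
   v (for v a vertex of G). *)
Definition nu T (v : nat) : node :=
  head [::] [seq child0 u | u <- td_nodes_of T
              & (if subtree (td_tree T) u is TOne _ then true else false)
                && forget_vertex_node (td_bag T) u v].

End Decompositions.

Definition treewidth (G : graph) (k : nat) : Prop :=
  (exists T : nice_td G, width T = Posz k) /\
  (forall T : nice_td G, (Posz k <= width T)%R).

Notation bitstring := (seq bool).

Record dp_core := DPCore {
  dp_leaf : {fset bitstring};
  dp_leaf_neq0 : dp_leaf != fset0;
  dp_intro_vertex : nat -> bitstring -> {fset bitstring};
  dp_intro_edge : nat -> nat -> bitstring -> {fset bitstring};
  dp_forget_vertex : nat -> bitstring -> {fset bitstring};
  dp_join : bitstring -> bitstring -> {fset bitstring};
  dp_final : bitstring -> bool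
}.

Section DynamicProgramming.
Variables (D : dp_core) (G : graph) (T : nice_td G).

(* IntroEdge applied with {v, v'} = endpts(e), in the order v <= v'. *)
Definition intro_edge_step (e : nat) (w : bitstring) : {fset bitstring} :=
  \bigcup_(v <- endpts G e)
    \bigcup_(v' <- endpts G e | (endpts G e == [fset v; v']) && (v <= v'))
      dp_intro_edge D v v' w.

(* At a node u with a single child, exactly one of the three families
   B(u) \ B(u'), B(u') \ B(u) and {e | xi(e) = u} is nonempty and that one is
   a singleton, so this is the value of the map matching the kind of u. *)
Definition single_child_step (u : node) (w : bitstring) : {fset bitstring} :=
  let B := td_bag T in
  (\bigcup_(v <- B u `\` B (child0 u)) dp_intro_vertex D v w) `|`
  (\bigcup_(v <- B (child0 u) `\` B u) dp_forget_vertex D v w) `|`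
  (\bigcup_(e <- gE G | td_xi T e == u) intro_edge_step e w).

Fixpoint Gamma_rec (t : tree) (u : node) : {fset bitstring} :=
  match t with
  | TLeaf => dp_leaf D
  | TOne t1 =>
      \bigcup_(w <- Gamma_rec t1 (child0 u)) single_child_step u w
  | TTwo t1 t2 =>
      \bigcup_(w <- Gamma_rec t1 (child0 u))
        \bigcup_(w' <- Gamma_rec t2 (child1 u)) dp_join D w w'
  end.

Definition Gamma (u : node) : {fset bitstring} :=
  Gamma_rec (subtree (td_tree T) u) u.

Definition dp_accepts : Prop := exists2 w, w \in Gamma [::] & dp_final D w.

Definition witness_tree (W : node -> bitstring) : Prop :=
  (forall u, u \in td_nodes_of T ->
     match subtree (td_tree T) u with
     | TLeaf => W u \in dp_leaf D
     | TOne _ => W u \in single_child_step u (W (child0 u))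
     | TTwo _ _ => W u \in dp_join D (W (child0 u)) (W (child1 u))
     end)
  /\ dp_final D (W [::]).

Definition extracted_set (mu : nat -> bitstring -> bool)
    (W : node -> bitstring) : {fset nat} :=
  [fset v in gV G | mu v (W (nu T v))].

End DynamicProgramming.

Definition dp_solves (D : dp_core) (Pi : vertex_subset_problem) : Prop :=
  forall (G : graph) (T : nice_td G),
    dp_accepts D T <-> exists X, Sol Pi G X.

Definition table_complexity (D : dp_core) (alpha : nat -> nat -> nat) : Prop :=
  forall (k : nat) (G : graph) (T : nice_td G), (width T <= Posz k)%R ->
    forall u, u \in td_nodes_of T ->
      (#|` Gamma D T u| <= alpha k #|` gV G|)%N.

Definition solution_preserving (D : dp_core) (Pi : vertex_subset_problem) :
    Prop :=
  exists mu : nat -> bitstring -> bool,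
    forall (G : graph) (T : nice_td G), dp_accepts D T ->
      (forall W, witness_tree D T W -> Sol Pi G (extracted_set T mu W)) /\
      (forall X, Sol Pi G X ->
         exists2 W, witness_tree D T W & extracted_set T mu W = X).

(* Deterministic one-tape Turing machines; None is the blank symbol, and a
   machine halts where its transition function is undefined. *)
Inductive move := MoveLeft | MoveStay | MoveRight.

Record turing_machine := TuringMachine {
  tm_state : finType;
  tm_extra : finType;
  tm_start : tm_state;
  tm_accept : pred tm_state;
  tm_delta : tm_state -> option (bool + tm_extra) ->
             option (tm_state * option (bool + tm_extra) * move)
}.

Section Runs.
Variable M : turing_machine.

Definition symbol := option (bool + tm_extra M).

Record config := Config {
  cf_state : tm_state M;
  cf_left : seq symbol; (* nearest cell first *)
  cf_head : symbol;
  cf_right : seq symbol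
}.

Definition tm_halted (c : config) : bool :=
  ~~ isSome (tm_delta (cf_state c) (cf_head c)).

Definition tm_step (c : config) : config :=
  match tm_delta (cf_state c) (cf_head c) with
  | None => c
  | Some (q, a, m) =>
      let l := cf_left c in let r := cf_right c in
      match m with
      | MoveLeft => Config q (behead l) (head None l) (a :: r)
      | MoveStay => Config q l a r
      | MoveRight => Config q (a :: l) (head None r) (behead r)
      end
  end.

Definition tm_init (x : bitstring) : config :=
  let s := [seq Some (inl b) | b <- x] in
  Config (tm_start M) [::] (head None s) (behead s).

Definition tm_answers_within (x : bitstring) (t : nat) (b : bool) : Prop :=
  let c := iter t tm_step (tm_init x) in
  tm_halted c /\ tm_accept (cf_state c) = b.

End Runs.

(* A literal is a variable with its sign, and a clause consists of three
   literals, repetitions being allowed. *)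
Definition cnf3 (n : nat) := seq (3.-tuple ('I_n * bool)).

Definition cnf3_sat (n : nat) (phi : cnf3 n) : bool :=
  [exists a : {ffun 'I_n -> bool},
     all (fun c : 3.-tuple ('I_n * bool) =>
            has (fun l : 'I_n * bool => a l.1 == l.2) c) phi].

Definition encode_literal (n : nat) (l : 'I_n * bool) : bitstring :=
  nseq l.1 true ++ [:: false; l.2].

Definition encode_cnf3 (n : nat) (phi : cnf3 n) : bitstring :=
  nseq n true ++ false ::
  flatten [seq flatten (map (@encode_literal n) c)
          | c : 3.-tuple ('I_n * bool) <- phi].

Definition little_o_id (g : nat -> nat) : Prop :=
  forall c, exists N, forall n, N <= n -> c * g n <= n.

(* The factor polynomial in the input length is needed because an n-variable
   formula may repeat its clauses arbitrarily often; without repetitions it is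
   2^o(n). *)
Definition ETH : Prop :=
  ~ exists (M : turing_machine) (g : nat -> nat) (d : nat),
      little_o_id g /\
      forall (n : nat) (phi : cnf3 n),
        exists2 t, t <= 2 ^ g n * size (encode_cnf3 phi) ^ d
                 & tm_answers_within M (encode_cnf3 phi) t (cnf3_sat phi).

(* Main.v *)
Require Import Defs.
From HB Require Import structures.
From mathcomp Require Import all_boot all_order all_algebra finmap.
From mathcomp Require Import all_classical all_reals all_analysis.
From mathcomp Require Import zify ring lra.
Import Order.TTheory GRing.Theory Num.Theory.
Import numFieldNormedType.Exports.
Set Implicit Arguments.
Unset Strict Implicit.
Unset Printing Implicit Defensive.
Local Open Scope ring_scope.
Local Open Scope classical_set_scope.

(** Independent sets have a solution-preserving DP-core whose table entries are
    the traces on the bag, so at most [2^(k+1)] of them.  Take bits b_1..b_m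
    with vertices u_i (b_i = 1), n_i (b_i = 0) and r_ij (b_i = 1 and b_j = 0),
    joined by the edges u_i n_i, r_ij n_i and r_ij u_j.  For a subset a of
    {1..m}, the inequality
      2 sum_(i in a) u_i + sum_(i, j in a) (n_i + r_ij) <= 1 + |a|^2
    is valid for the independent set polytope, since n_i + r_ij <= 1 - u_i u_j,
    and has slack (1 - |a cap b|)^2 at the independent set encoding b.  An
    extension with r inequalities covers the nonzero slacks by r rectangles, one
    per inequality, and the counting argument of Kaibel and Weltge for unique
    disjointness gives 3^m <= (r + 1) 2^m.  The graph has O(m^2) vertices, and
    all r_ij are pairwise nonadjacent, so its treewidth is O(m); a disjoint
    clique makes it at least m - 1.  Hence the extension complexity is
    2^Omega(k) with n polynomial in k, while alpha^o(1) n^O(1) is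
    2^o(k). *)

(** * Rectangle covers of the disjoint pairs of subsets *)

Section UniqueDisjointness.
Local Open Scope nat_scope.
Implicit Types (m : nat) (a b : seq bool) (A B : pred (seq bool)).

Definition common m a b : nat := \sum_(i < m) (nth false a i && nth false b i).

Lemma common_cons m x y a b :
  common m.+1 (x :: a) (y :: b) = (x && y) + common m a b.
Proof. by rewrite /common big_ord_recl. Qed.

(** A recursive form of summation over disjoint pairs, so that inductions split off the first
    coordinate without reindexing. *)
Fixpoint disj_sum m (f : seq bool -> seq bool -> nat) : nat :=
  if m is m'.+1 then
    disj_sum m' (fun a b => f (false :: a) (false :: b)) +
    disj_sum m' (fun a b => f (true :: a) (false :: b)) +
    disj_sum m' (fun a b => f (false :: a) (true :: b))
  else f [::] [::].

Lemma leq_disj_sum m f g :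
  (forall a b, size a = m -> size b = m -> common m a b = 0 -> f a b <= g a b) ->
  disj_sum m f <= disj_sum m g.
Proof.
elim: m f g => [|m IH] f g fg /=; first by apply: fg => //; rewrite /common big_ord0.
by rewrite !leq_add ?IH // => a b sa sb ab; apply: fg => /=;
  rewrite ?sa ?sb ?common_cons.
Qed.

Lemma disj_sumD m f g :
  disj_sum m (fun a b => f a b + g a b) = disj_sum m f + disj_sum m g.
Proof. by elim: m f g => [|m IH] f g //=; rewrite !IH; lia. Qed.

Lemma disj_sum_sum (I : Type) (r : seq I) m (f : I -> seq bool -> seq bool -> nat) :
  disj_sum m (fun a b => \sum_(i <- r) f i a b) = \sum_(i <- r) disj_sum m (f i).
Proof.
elim: m f => [|m IH] f //=.
by rewrite !IH -!big_split.
Qed.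

Lemma disj_sum1 m : disj_sum m (fun _ _ => 1) = 3 ^ m.
Proof. by elim: m => [|m IH] //=; rewrite IH expnS; lia. Qed.

Definition rect A B a b : nat := A a && B b.

(* A disjoint pair of length m extends inside A x B by at most two of the
   three pairs (0,0), (1,0), (0,1) of first coordinates: (1,0) and (0,1)
   together would give (1,1), hence a pair with exactly one common element.
   Two rectangles of dimension m account for these extensions. *)
Lemma rect_disj_sum m A B :
  (forall a b, size a = m -> size b = m -> A a -> B b -> common m a b <> 1) ->
  disj_sum m (rect A B) <= 2 ^ m.
Proof.
elim: m A B => [|m IH] A B AB /=; first by rewrite /rect; case: andb.
pose A0 a := A (false :: a); pose A1 a := A (true :: a).
pose B0 b := B (false :: b); pose B1 b := B (true :: b).
have h1 : disj_sum m (rect (predU A0 A1) B0) <= 2 ^ m.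
  apply: IH => a b sa sb /orP[] Aa Bb;
    [have := AB (false :: a) (false :: b)|have := AB (true :: a) (false :: b)];
  by rewrite /= sa sb common_cons; apply.
have h2 : disj_sum m (rect A0 (predU B0 B1)) <= 2 ^ m.
  apply: IH => a b sa sb Aa /orP[] Bb;
    [have := AB (false :: a) (false :: b)|have := AB (false :: a) (true :: b)];
  by rewrite /= sa sb common_cons; apply.
rewrite -!disj_sumD expnS mul2n -addnn.
apply: leq_trans (leq_add h1 h2); rewrite -disj_sumD.
apply: leq_disj_sum => a b sa sb ab.
have := AB (true :: a) (true :: b); rewrite /= sa sb common_cons ab.
rewrite /rect /= -/(A0 a) -/(A1 a) -/(B0 b) -/(B1 b).
by case: (A0 a); case: (A1 a); case: (B0 b); case: (B1 b) => //= h;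
  exfalso; apply: h.
Qed.

(** Double counting: each of the $3^m$ disjoint pairs lies in some rectangle, and by [rect_disj_sum]
    no rectangle contains more than $2^m$ of them. *)
Lemma rect_cover m (I : finType) (A B : I -> pred (seq bool)) :
  (forall i a b, size a = m -> size b = m -> A i a -> B i b ->
     common m a b <> 1) ->
  (forall a b, size a = m -> size b = m -> common m a b = 0 ->
     exists i, A i a && B i b) ->
  3 ^ m <= #|I| * 2 ^ m.
Proof.
move=> AB cov; rewrite -disj_sum1.
apply: (@leq_trans (\sum_(i : I) disj_sum m (rect (A i) (B i)))).
  rewrite -disj_sum_sum; apply: leq_disj_sum => a b sa sb ab.
  have [i abi] := cov _ _ sa sb ab.
  by rewrite (bigD1 i) //= /rect abi.
rewrite -sum_nat_const; apply: leq_sum => i _.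
by apply: rect_disj_sum => a b sa sb; apply: AB.
Qed.

End UniqueDisjointness.

(** * Rectangles obtained from the inequalities of an extension *)

Section FaceRectangles.
Variables (R : realType) (E : lmodType R).

(* Some [z] on the face [psi = del] has slack in every constraint that is not
   tight on the whole face; if [y] were off the face, the segment from [y] to
   [z] could be prolonged beyond [z] inside the polyhedron. *)
Lemma face_tight (d r : nat) (A : 'M[R]_(r, d)) (b : 'cV[R]_r)
    (psi : 'cV[R]_d -> R) (del : R) (z0 y : 'cV[R]_d) :
  (forall k u v, psi (k *: u + v) = k * psi u + psi v) ->
  (forall x, polyhedron A b x -> psi x <= del) ->
  polyhedron A b z0 -> psi z0 = del -> polyhedron A b y ->
  (forall i, (forall x, polyhedron A b x -> psi x = del ->
     (A *m x) i 0 = b i 0) -> (A *m y) i 0 = b i 0) ->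
  psi y = del.
Proof.
move=> lin val Pz0 z0d Py tight.
pose face x := polyhedron A b x /\ psi x = del.
pose tgt i := forall x, polyhedron A b x -> psi x = del -> (A *m x) i 0 = b i 0.
have Acomb k (u v : 'cV[R]_d) i :
    (A *m (k *: u + v)) i 0 = k * (A *m u) i 0 + (A *m v) i 0.
  by rewrite mulmxDr -scalemxAr !mxE.
have psi0 : psi 0 = 0 by have := lin 1 0 0; rewrite scaler0 addr0; lra.
have psiZ k u : psi (k *: u) = k * psi u by rewrite -[k *: u]addr0 lin psi0 addr0.
have AZ k (u : 'cV[R]_d) i : (A *m (k *: u)) i 0 = k * (A *m u) i 0.
  by rewrite -scalemxAr mxE.
(* Built constraint by constraint: the midpoint of [z] and a face point with slack in constraint [j]
   stays on the face and keeps the slack already gained. *)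
have [z [Pz zd] zs] : exists2 z, face z &
    forall i, i \in enum 'I_r -> ~ tgt i -> (A *m z) i 0 < b i 0.
  elim: (enum 'I_r) => [|j s [z [Pz zd] zs]]; first by exists z0.
  have [tj|ntj] := pselect (tgt j).
    exists z => // i; rewrite inE => /orP[/eqP ->//|]; exact: zs.
  have [x [Px xd] xj] : exists2 x, face x & (A *m x) j 0 < b j 0.
    apply: contrapT => no; apply: ntj => x Px xd.
    have := Px j; rewrite le_eqVlt => /orP[/eqP//|lt]; exfalso.
    by apply: no; exists x.
  exists (2^-1 *: x + 2^-1 *: z).
    split; last by rewrite lin psiZ xd zd; lra.
    by move=> i; rewrite Acomb AZ; have := Px i; have := Pz i; lra.
  move=> i; rewrite inE Acomb AZ => /orP[/eqP ->|/zs zi /zi].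
    by move=> _; have := Pz j; lra.
  by have := Px i; lra.
(* A minimum over the constraints. One that is tight on the face is tight at [z] and at [y], so any
   [t] satisfies it; for the others the slack [g] at [z] bounds [t], with 1 added to the denominator
   to avoid division by zero. *)
have [t t0 ts] : exists2 t : R, 0 < t &
    forall i, i \in enum 'I_r -> (A *m (t *: (z - y) + z)) i 0 <= b i 0.
  elim: (enum 'I_r) (zs) => [|j s IH] zs'; first by exists 1.
  have [i si|t t0 ts] := IH; first by apply: zs'; rewrite inE si orbT.
  pose D := (A *m (z - y)) j 0; pose g := b j 0 - (A *m z) j 0.
  have [tj|ntj] := pselect (tgt j).
    exists t => // i; rewrite inE => /orP[/eqP ->|]; last exact: ts.
    have -> : z - y = (-1) *: y + z by rewrite scaleN1r addrC.
    by rewrite !Acomb (tj z) // tight //; lra.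
  have g0 : 0 < g by rewrite subr_gt0; apply: zs' => //; rewrite inE eqxx.
  have D1 : 0 < `|D| + 1 by rewrite ltr_wpDl.
  exists (Num.min t (g / (`|D| + 1))); first by rewrite lt_min t0 divr_gt0.
  move=> i; rewrite inE Acomb => /orP[/eqP ->|si].
    rewrite -/D -lerBrDr -/g.
    apply: (@le_trans _ _ ((g / (`|D| + 1)) * `|D|)).
      apply: le_trans (ler_wpM2l _ (ler_norm D)) _.
        by rewrite le_min !ltW // divr_gt0.
      by rewrite ler_wpM2r // ge_min lexx orbT.
    by rewrite mulrAC ler_pdivrMr // ler_pM2l // lerDl.
  have := ts i si; rewrite Acomb.
  have [D0|/ltW D0] := leP 0 ((A *m (z - y)) i 0).
    by apply: le_trans; rewrite lerD2r ler_wpM2r // ge_min lexx.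
  move=> _; rewrite -[leRHS]add0r; apply: lerD; last exact: Pz.
  by rewrite mulr_ge0_le0 // le_min !ltW // divr_gt0.
have : psi (t *: (z - y) + z) <= del by apply: val => i; apply: ts; rewrite mem_enum.
have -> : z - y = (-1) *: y + z by rewrite scaleN1r addrC.
(* The value at the prolonged point exceeds [del] by [t] times [del - psi y], so validity forces
   [psi y >= del]. *)
rewrite !lin zd -lerBrDr subrr pmulr_rle0 //.
by have := val y Py; lra.
Qed.

(** The support form of one half of Yannakakis' theorem. Constraint [i] yields the rectangle of
    those [a] on whose lifted face it is tight and those [b] whose chosen lift has slack in it. Such
    slack puts the lift off the face; conversely, by [face_tight], a lift off the face has slack in
    one of these constraints. *)
Lemma extension_rect_cover (P : set E) (r : nat) (I J : Type)
    (phi : I -> E -> R) (del : I -> R) (p : J -> E) :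
  has_extension P r ->
  (forall a k u v, phi a (k *: u + v) = k * phi a u + phi a v) ->
  (forall a x, P x -> phi a x <= del a) ->
  (forall a, exists2 x, P x & phi a x = del a) ->
  (forall b, P (p b)) ->
  exists (A : 'I_r -> I -> Prop) (B : 'I_r -> J -> Prop),
    forall a b, phi a (p b) < del a <-> exists2 i, A i a & B i b.
Proof.
move=> [d [M [c [f [_ fP]]]]] lin val tight Pp.
have /choice[y hy] : forall b, exists y, polyhedron M c y /\ f y = p b.
  by move=> b; have := Pp b; rewrite -fP => -[x Qx fx]; exists x.
exists (fun i a => forall x, polyhedron M c x -> phi a (f x) = del a ->
          (M *m x) i 0 = c i 0), (fun i b => (M *m y b) i 0 < c i 0) => a b.
have [Qy fy] := hy b; split=> [lt|[i ti lt]].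
  apply: contrapT => no.
  have [x0 + x0d] := tight a; rewrite -{1}fP => -[z0 Qz0 z0x].
  suff : phi a (f (y b)) = del a by rewrite fy => e; rewrite e ltxx in lt.
  apply: (@face_tight d r M c (phi a \o f) (del a) z0) => //=.
  - by move=> k u v; rewrite linearP lin.
  - by move=> x Qx; apply: val; rewrite -fP; exists x.
  - by rewrite z0x.
  move=> i ti; have := Qy i; rewrite le_eqVlt => /orP[/eqP//|lti].
  by exfalso; apply: no; exists i.
rewrite lt_neqAle val // andbT; apply/eqP => e.
by move: lt; rewrite ti ?ltxx // fy.
Qed.

Lemma convex_hull_le (S : set E) (phi : E -> R) (del : R) :
  (forall k u v, phi (k *: u + v) = k * phi u + phi v) ->
  (forall x, S x -> phi x <= del) ->
  forall x, convex_hull S x -> phi x <= del.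
Proof.
move=> lin val x [m [l [p [l0 l1 Sp ->]]]].
have phi0 : phi 0 = 0 by have := lin 1 0 0; rewrite scaler0 addr0; lra.
have -> : phi (\sum_i l i *: p i) = \sum_i l i * phi (p i).
  apply: (big_ind2 (fun u a => phi u = a)) => // [u a v b ua vb|i _].
    by rewrite -[u]scale1r lin mul1r ua vb.
  by rewrite -[_ *: _]addr0 lin phi0 addr0.
rewrite -[del]mul1r -l1 mulr_suml; apply: ler_sum => i _.
by rewrite ler_wpM2l // val.
Qed.

Lemma sub_convex_hull (S : set E) : S `<=` convex_hull S.
Proof.
move=> x Sx; exists 1%N, (fun=> 1), (fun=> x); split=> //.
  by rewrite big_ord1.
by rewrite big_ord1 scale1r.
Qed.

End FaceRectangles.

(** * Nodes of a tree as addresses *)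

Section TreeAddresses.
Local Open Scope nat_scope.

Lemma nodes_rcons t u x : rcons u x \in nodes t -> u \in nodes t.
Proof.
elim: t u => [|t1 IH1|t1 IH1 t2 IH2] [|y u] //=.
  rewrite !inE /= => /mapP[w wt [-> e]]; apply/mapP; exists u => //.
  by apply: IH1; rewrite e.
rewrite !inE /= !mem_cat => /orP[] /mapP[w wt [-> e]]; apply/orP.
  by left; apply/mapP; exists u => //; apply: IH1; rewrite e.
by right; apply/mapP; exists u => //; apply: IH2; rewrite e.
Qed.

Lemma subtree_rcons t u x : rcons u x \in nodes t ->
  subtree t (rcons u x) = subtree (subtree t u) [:: x].
Proof.
elim: t u => [|t1 IH1|t1 IH1 t2 IH2] [|y u] //=.
  by rewrite !inE /= => /mapP[w wt [-> e]]; apply: IH1; rewrite e.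
by rewrite !inE /= !mem_cat => /orP[] /mapP[w wt [-> e]];
  [apply: IH1|apply: IH2]; rewrite e.
Qed.

Lemma subtree_nil t : subtree t [::] = t.
Proof. by case: t. Qed.

Lemma nil_nodes t : [::] \in nodes t.
Proof. by case: t => [|t|t1 t2]; rewrite /= inE. Qed.

Lemma child_nodes t u x : u \in nodes t ->
  (rcons u x \in nodes t) =
  match subtree t u with TLeaf => false | TOne _ => ~~ x | TTwo _ _ => true end.
Proof.
have inj y : injective (cons (y : bool)) by move=> ? ? [].
have notin y w (s : seq (seq bool)) : ((~~ y) :: w \in map (cons y) s) = false.
  by apply/mapP => -[z _ [e _]]; case: y e.
elim: t u => [|t1 IH1|t1 IH1 t2 IH2] [|y u] //=; rewrite ?inE //=.
- case: x {IH1} => _; first exact: (notin false).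
  by rewrite (mem_map (@inj false)) nil_nodes.
- case: y => /=; first by rewrite (notin false).
  by rewrite !(mem_map (@inj false)); apply: IH1.
- move=> _; rewrite mem_cat; case: x {IH1 IH2}.
    by rewrite (mem_map (@inj true)) nil_nodes orbT.
  by rewrite (mem_map (@inj false)) nil_nodes.
- rewrite !mem_cat; case: y => /=.
    by rewrite !(notin false) /= !(mem_map (@inj true)); apply: IH2.
  by rewrite !(notin true) !orbF !(mem_map (@inj false)); apply: IH1.
Qed.

Lemma tree_adjP u w : tree_adj u w ->
  exists x, w = rcons u x \/ u = rcons w x.
Proof.
case/or4P => /eqP ->; [exists false; left|exists true; left|exists false; right|
  exists true; right] => //.
Qed.

End TreeAddresses.

(** * Forget nodes and a lower bound on the width *)

Section Forgetting.
Local Open Scope nat_scope.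
Local Open Scope fset_scope.
Variables (G : graph) (T : nice_td G).
Local Notation B := (td_bag T).

Definition one_child (u : node) : bool :=
  if subtree (td_tree T) u is TOne _ then true else false.

(** Introduce nodes contain the bag of their child and joins repeat the bags of both children, so a
    vertex is lost on the way up only at a forget node. *)
Lemma forget_nodeP u v x :
  rcons u x \in nodes (td_tree T) -> v \in B (rcons u x) -> v \notin B u ->
  [/\ x = false, one_child u & forget_vertex_node B u v].
Proof.
move=> ux vx vu; have un := nodes_rcons ux.
have := td_nodes un; have := child_nodes x un; rewrite ux /one_child.
case: (subtree _ u) => // [t1|t1 t2].
  case: x vx {ux} => // vx _; rewrite -/(child0 u) in vx.
  case=> [[w [sub _]]|[w fw]|[e [eB _ _]]].
  - by rewrite (fsubsetP sub) in vu.
  - split=> //; have /andP[sub /eqP eD] := fw.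
    have : v \in B (child0 u) `\` B u by rewrite inE vu vx.
    by rewrite eD inE => /eqP ->.
  - by rewrite eB vx in vu.
move=> _ [e0 e1]; case: x vx {ux} => vx.
  by rewrite e1 vx in vu.
by rewrite e0 vx in vu.
Qed.

Lemma forget_above v u y :
  u ++ y \in nodes (td_tree T) -> v \in B (u ++ y) -> v \notin B u ->
  exists z, [/\ u ++ z \in nodes (td_tree T), one_child (u ++ z) &
                forget_vertex_node B (u ++ z) v].
Proof.
elim/last_ind: y => [|y x IH]; first by rewrite cats0 => _ ->.
rewrite -rcons_cat => nyx vyx vu.
have [vy|vy] := boolP (v \in B (u ++ y)).
  by apply: IH => //; apply: nodes_rcons nyx.
have [_ ho hf] := forget_nodeP nyx vyx vy.
by exists y; split=> //; apply: nodes_rcons nyx.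
Qed.

Lemma forget_node_bag u v : forget_vertex_node B u v ->
  v \in B (child0 u) /\ v \notin B u.
Proof.
case/andP=> _ /eqP e.
have : v \in B (child0 u) `\` B u by rewrite e inE.
by rewrite inE => /andP[].
Qed.

(** The root bag is empty, so some node above any bag containing [v] forgets it; thus the list in
    [nu] is nonempty and its head is not the default [[::]]. *)
Lemma nuP v : v \in gV G -> nu T v \in nodes (td_tree T) /\ v \in B (nu T v).
Proof.
move=> vG; have [y ny vy] := td_cover T vG.
have [|z [nz oz fz]] := @forget_above v [::] y ny vy; first by rewrite td_root.
rewrite /nu.
set s := [seq _ <- _ | _].
have : z \in s by rewrite mem_filter fz nz andbT /= andbT.
have : all (fun u => [&& u \in nodes (td_tree T), one_child u &
    forget_vertex_node B u v]) s.
  apply/allP => u; rewrite mem_filter => /andP[/andP[ho hf] hn].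
  by rewrite hf andbT; apply/andP.
case: s => // u s /= /andP[/and3P[hn ho hf] _] _.
split; last by have [] := forget_node_bag hf.
rewrite /child0 child_nodes //; move: ho; rewrite /one_child.
by case: (subtree _ u).
Qed.

(* Removing the edge above a node at whose parent [v] is missing confines the
   bags containing [v] to the subtree of that node. *)
Lemma connected_below u v w :
  child0 u \in nodes (td_tree T) -> v \in B (child0 u) -> v \notin B u ->
  w \in nodes (td_tree T) -> v \in B w -> exists y, w = child0 u ++ y.
Proof.
move=> nc vc vu nw vw; have [p [pp <- vp]] := td_connected nc nw vc vw.
have : exists y, child0 u = child0 u ++ y by exists [::]; rewrite cats0.
elim: p {1 2 4}(child0 u) pp vp => [|x p IH] c //= /andP[cx px] vp [y cy].
apply: IH px _ _ => [z zp|]; first by apply: vp; rewrite inE zp orbT.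
have [nx vx] := vp x (mem_head _ _).
have [b [->|cxb]] := tree_adjP cx.
  by exists (rcons y b); rewrite cy rcons_cat.
case/lastP: y cy => [|y b'] cy.
  move: cxb; rewrite cy cats0 => /rcons_inj [ux _].
  by rewrite ux vx in vu.
by move: cxb; rewrite cy -rcons_cat => /rcons_inj [<- _]; exists y.
Qed.

(* The deepest node forgetting a vertex of [S] still has all neighbours in [S]
   of that vertex in the bag of its child. *)
Lemma min_degree_width (S : {fset nat}) (N : nat -> {fset nat}) (d : nat) :
  S != fset0 -> S `<=` gV G ->
  (forall v, v \in S -> [/\ N v `<=` S, v \notin N v & d <= #|` N v|]) ->
  (forall v w, v \in S -> w \in N v ->
     exists2 e, e \in gE G & (v \in endpts G e) && (w \in endpts G e)) ->
  d < \max_(u <- td_nodes_of T) #|` B u|.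
Proof.
move=> /fset0Pn[v0 v0S] SV SN NE.
(* A vertex of [S] is forgotten at depth [n]; depths are bounded, so a deepest such node exists. *)
pose P n := `[< exists u v, [/\ v \in S, u \in nodes (td_tree T), one_child u,
   forget_vertex_node B u v & size u = n] >].
have forgets v : v \in S -> exists u, [/\ u \in nodes (td_tree T), one_child u &
    forget_vertex_node B u v].
  move=> vS; have [y ny vy] := td_cover T (fsubsetP SV _ vS).
  by apply: (@forget_above v [::] y ny vy); rewrite td_root.
have exP : exists n, P n.
  have [u [nu0 ou fu]] := forgets _ v0S.
  by exists (size u); apply/asboolP; exists u, v0.
have ubP n : P n -> n <= \max_(u <- nodes (td_tree T)) size u.
  by move=> /asboolP[u [v [_ un _ _ <-]]]; apply: leq_bigmax_seq.
case: (ex_maxnP exP ubP) => n /asboolP[u [v [vS un ou fu su]]] maxn.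
have [vc vu] := forget_node_bag fu.
have nc : child0 u \in nodes (td_tree T).
  by rewrite /child0 child_nodes //; move: ou; rewrite /one_child; case: subtree.
have [NS vN dN] := SN _ vS.
suff sub : v |` N v `<=` B (child0 u).
  apply: leq_trans (_ : #|` B (child0 u)| <= _); last exact: leq_bigmax_seq.
  apply: leq_trans (fsubset_leq_card sub).
  by rewrite cardfsU1 vN add1n ltnS.
apply/fsubsetP => w; rewrite !inE => /orP[/eqP ->//|wN].
have [e eG /andP[ve we]] := NE _ _ vS wN.
have nx := td_xi_node T eG; have /fsubsetP sx := td_xi_endpts T eG.
(* The edge [e] is introduced at or below [child0 u], with [w] in the bag there. If [w] were missing
   at [child0 u], it would be forgotten deeper than [u], against maximality. *)
have [y xy] := connected_below nc vc vu nx (sx _ ve).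
apply: contraT => wc; rewrite xy in nx sx.
have [z [nz oz fz]] := forget_above nx (sx _ we) wc.
have : P (size (child0 u ++ z)).
  by apply/asboolP; exists (child0 u ++ z), w; split=> //; apply: (fsubsetP NS).
by move/maxn; rewrite size_cat size_rcons su addSn ltnNge leq_addr.
Qed.

End Forgetting.

(** * A solution-preserving DP-core for independent sets *)

Section IndependentSet.
Local Open Scope nat_scope.
Local Open Scope fset_scope.

Definition independent (G : graph) (X : {fset nat}) : bool :=
  (X `<=` gV G) && [forall e : gE G, ~~ (endpts G (val e) `<=` X)].

Lemma independentP G X :
  reflect (X `<=` gV G /\ forall e, e \in gE G -> ~~ (endpts G e `<=` X))
          (independent G X).
Proof.
apply: (iffP andP) => -[XV].
  by move=> /forallP h; split=> // e eG; exact: (h [` eG]).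
by move=> h; split=> //; apply/forallP => e; apply: h; apply: valP.
Qed.

Lemma in_endpts G e v : e \in gE G ->
  (v \in endpts G e) = ((e, v) \in ginc G).
Proof.
move=> eG; rewrite /endpts /endpts_of !inE /= andb_idl // => ev.
by have := fsubsetP (ginc_sub G) _ ev; rewrite !inE => /andP[].
Qed.

Lemma endpts_sub G e : endpts G e `<=` gV G.
Proof. by apply/fsubsetP => v; rewrite /endpts /endpts_of !inE => /andP[]. Qed.

Lemma independent_iso G H f1 f2 X : graph_iso G H f1 f2 ->
  independent G X -> independent H [fset f1 v | v in X].
Proof.
case=> i1 m1 i2 m2 inc /independentP[XV ind]; apply/independentP; split.
  rewrite -m1; apply/fsubsetP => _ /imfsetP[v vX ->]; apply/imfsetP.
  by exists v => //; apply: (fsubsetP XV).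
rewrite -m2 => _ /imfsetP[e eG ->]; apply: contra (ind e eG) => /fsubsetP sub.
have f2e : f2 e \in gE H by rewrite -m2; apply/imfsetP; exists e.
apply/fsubsetP => v ve; have vG := fsubsetP (endpts_sub G e) _ ve.
have : f1 v \in endpts H (f2 e) by rewrite in_endpts // inc // -in_endpts.
move/sub/imfsetP => [w wX /i1 ->] //; exact: (fsubsetP XV).
Qed.

Definition independent_set : vertex_subset_problem.
Proof.
refine (@VertexSubsetProblem [set p | independent p.1 p.2]%classic _ _).
  by move=> G X /= /independentP[].
exact: independent_iso.
Defined.

Lemma independent0 G : independent G fset0.
Proof.
apply/independentP; split=> [|e eG]; first exact: fsub0set.
have [v [v' eq]] := ginc_endpts eG.
by apply/fsubsetPn; exists v; rewrite // /endpts eq !inE eqxx.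
Qed.

(** A set is stored in unary, as the length of the string. Table complexity counts strings and not
    their lengths, so this wasteful code is harmless. *)
Definition enc (X : {fset nat}) : bitstring := nseq (choice.pickle X) true.
Definition dec (w : bitstring) : {fset nat} :=
  odflt fset0 (choice.unpickle (size w)).

Lemma encK : cancel enc dec.
Proof. by move=> X; rewrite /dec size_nseq choice.pickleK. Qed.

Lemma fset1_neq0 (K : choiceType) (x : K) : [fset x] != fset0.
Proof. by apply/fset0Pn; exists x; rewrite inE. Qed.

(** An entry encodes the trace of an independent set on the bag: an introduced vertex is left out or
    taken, an edge discards traces containing its endpoints, and a join requires equal traces.
    Conflicts are removed on the way, so everything that reaches the root is accepted. *)
Definition indset_core : dp_core := DPCore
  (fset1_neq0 (enc fset0))
  (fun v w => [fset w; enc (v |` dec w)])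
  (fun v v' w => if [fset v; v'] `<=` dec w then fset0 else [fset w])
  (fun v w => [fset enc (dec w `\ v)])
  (fun w w' => if w == w' then [fset w] else fset0)
  predT.

Section Correctness.
Variables (G : graph) (T : nice_td G).
Local Notation B := (td_bag T).
Local Notation D := indset_core.

Lemma intro_edge_stepP e w w' : e \in gE G ->
  (w' \in intro_edge_step D G e w) = (w' == w) && ~~ (endpts G e `<=` dec w).
Proof.
move=> eG; apply/bigfcupP/andP => [[v /andP[ve _]]|[/eqP -> nsub]].
  case/bigfcupP => v' /andP[ve' /andP[/eqP -> _]] /=.
  by case: ifP => _; rewrite !inE.
have [v [v' eq]] := ginc_endpts eG; rewrite -/(endpts G e) in eq.
wlog vv' : v v' eq / v <= v'.
  move=> h; have [/(h v v' eq) //|/ltnW /(h v' v)] := leqP v v'.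
  by apply; rewrite eq fsetUC.
exists v; first by rewrite eq !inE eqxx.
apply/bigfcupP; exists v'; first by rewrite !eq !inE !eqxx orbT vv'.
by rewrite /= -eq (negPf nsub) inE.
Qed.

Lemma single_child_stepP u w w' : reflect
  [\/ exists2 v, v \in B u `\` B (child0 u) & w' \in [fset w; enc (v |` dec w)],
      exists2 v, v \in B (child0 u) `\` B u & w' = enc (dec w `\ v)
    | exists e, [/\ e \in gE G, td_xi T e = u, w' = w
                  & ~~ (endpts G e `<=` dec w)]]
  (w' \in single_child_step D T u w).
Proof.
rewrite /single_child_step !in_fsetU; apply: (iffP idP).
  case/orP => [/orP[]|] /bigfcupP[v].
  - by rewrite andbT => vB h; constructor 1; exists v.
  - by rewrite andbT => vB; rewrite inE => /eqP h; constructor 2; exists v.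
  - move=> /andP[vE /eqP xv]; rewrite intro_edge_stepP // => /andP[/eqP -> h].
    by constructor 3; exists v.
case=> [[v vB h]|[v vB ->]|[e [eG xe -> h]]]; rewrite -!orbA; apply/or3P.
- by constructor 1; apply/bigfcupP; exists v; rewrite ?vB.
- by constructor 2; apply/bigfcupP; exists v; rewrite ?vB //= inE.
- constructor 3; apply/bigfcupP; exists e; first by rewrite eG xe eqxx.
  by rewrite intro_edge_stepP // eqxx h.
Qed.

Lemma witness_Gamma W : witness_tree D T W ->
  forall u, u \in nodes (td_tree T) -> W u \in Gamma D T u.
Proof.
move=> [HW _] u; rewrite /Gamma.
move: {-1}(subtree _ u) (erefl (subtree (td_tree T) u)) => t.
elim: t u => [|t IH|t1 IH1 t2 IH2] u ut un; have := HW u un; rewrite ut //= => Wu.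
  apply/bigfcupP; exists (W (child0 u)) => //; rewrite andbT.
  have nc : child0 u \in nodes (td_tree T) by rewrite child_nodes // ut.
  by apply: IH => //; rewrite /child0 subtree_rcons // ut /= subtree_nil.
have nc0 : child0 u \in nodes (td_tree T) by rewrite child_nodes // ut.
have nc1 : child1 u \in nodes (td_tree T) by rewrite child_nodes // ut.
apply/bigfcupP; exists (W (child0 u)).
  by rewrite andbT; apply: IH1 => //; rewrite /child0 subtree_rcons // ut /= subtree_nil.
apply/bigfcupP; exists (W (child1 u)) => //.
by rewrite andbT; apply: IH2 => //; rewrite /child1 subtree_rcons // ut /= subtree_nil.
Qed.

(** Restricting one set to all bags obeys every local rule; independence enters at the
    introduce-edge nodes. *)
Lemma trace_witness X : independent G X ->
  witness_tree D T (fun u => enc (X `&` B u)).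
Proof.
move=> /independentP[XV ind]; split=> // u un.
have := td_nodes un; case us : (subtree _ u) => [|t|t1 t2].
- by move=> ->; rewrite /= inE fsetI0.
- case=> [[v [sub eD]]|[v /andP[sub /eqP eD]]|[e [eB eG xe]]];
    apply/single_child_stepP.
  + constructor 1; exists v; first by rewrite eD inE.
    have eB : B u = v |` B (child0 u).
      apply/fsetP => x; move/fsetP/(_ x): (eD); have := fsubsetP sub x.
      by rewrite !inE; case: (x \in B (child0 u)) => [h _|_ <-]; rewrite ?h ?orbT ?orbF.
    rewrite encK !inE eB; have [vX|vX] := boolP (v \in X); apply/orP.
      right; apply/eqP; congr enc; apply/fsetP => x; rewrite !inE.
      by case: eqVneq => [->|]; rewrite ?vX //= andbT.
    left; apply/eqP; congr enc; apply/fsetP => x; rewrite !inE.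
    by case: eqVneq => [->|]; rewrite ?(negPf vX).
  + constructor 2; exists v; first by rewrite eD inE.
    rewrite encK; congr enc; apply/fsetP => x; rewrite !inE.
    move/fsetP/(_ x): (eD); have := fsubsetP sub x; rewrite !inE.
    by case: (x \in B u) => [h <-|_ <-]; rewrite /= ?h //; case: (x \in B _); rewrite ?andbF.
  + constructor 3; exists e; rewrite encK eB; split=> //.
    apply: contra (ind _ eG) => h; apply: fsubset_trans h _.
    exact: fsubsetIl.
- by move=> [<- <-]; rewrite /= eqxx inE.
Qed.

Lemma indset_accepts : dp_accepts D T.
Proof.
exists (enc (fset0 `&` B [::])) => //.
exact: (witness_Gamma (trace_witness (independent0 G)) (nil_nodes _)).
Qed.

Local Notation mu := (fun v w => v \in dec w).

Lemma trace_extracted X : independent G X ->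
  extracted_set T mu (fun u => enc (X `&` B u)) = X.
Proof.
move=> /independentP[/fsubsetP XV _]; apply/fsetP => v; rewrite !inE /= encK inE.
have [vG|vG] := boolP (v \in gV G); last by apply/esym/negP => /XV; apply/negP.
by have [_ ->] := nuP T vG; rewrite andbT.
Qed.

(** A transition changes the encoded set at most at the vertex introduced or forgotten, which is not
    in both bags; joins leave it unchanged. *)
Lemma witness_adj W u w v : witness_tree D T W -> tree_adj u w ->
  u \in nodes (td_tree T) -> w \in nodes (td_tree T) ->
  v \in B u -> v \in B w -> (v \in dec (W u)) = (v \in dec (W w)).
Proof.
move=> [HW _] /tree_adjP[x].
wlog wu : u w / w = rcons u x.
  by move=> h [e|e] nu0 nw vu vw; [|apply/esym]; apply: h => //; left.
move=> _ nu0; rewrite wu => nw vu vw.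
have := HW u nu0; have := child_nodes x nu0; rewrite nw.
case: (subtree _ u) => // [t|t1 t2].
  case: x wu nw vw => // _ _ vw _ /single_child_stepP.
  rewrite -/(child0 u) in vw *.
  case=> [[z]|[z]|[e [_ _ -> _]] //]; rewrite inE => /andP[z1 z2].
    rewrite !inE => /orP[] /eqP -> //; rewrite encK !inE.
    by case: eqVneq => // e; rewrite -e vw in z1.
  by move=> ->; rewrite encK !inE; case: eqVneq => // e; rewrite -e vu in z1.
move=> _ /=; case: ifP => [/eqP e|//]; rewrite inE => /eqP ->.
by case: x {wu nw vw} => //; rewrite e.
Qed.

(** Agreement spreads along the path from [u] to [nu T v] through bags containing [v], so the set
    read off below the forget nodes has the entries of [W] as its traces. *)
Lemma witness_extracted W u v : witness_tree D T W ->
  u \in nodes (td_tree T) -> v \in B u ->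
  (v \in dec (W u)) = (v \in extracted_set T mu W).
Proof.
move=> HW un vu; have vG := fsubsetP (td_bag_sub un) _ vu.
rewrite !inE vG /=; have [nn vn] := nuP T vG.
have [p [+ <-]] := td_connected un nn vu vn.
elim: p u un vu => //= x p IH u un vu /andP[ux px] hp.
have [nx vx] := hp x (mem_head _ _).
rewrite (witness_adj HW ux) //; apply: IH => // y yp.
by apply: hp; rewrite inE yp orbT.
Qed.

(** At [td_xi T e] the bag contains the endpoints of [e], so the encoded and the extracted set agree
    on them, and the transition there has excluded that all of them are chosen. *)
Lemma witness_independent W : witness_tree D T W ->
  independent G (extracted_set T mu W).
Proof.
move=> HW; apply/independentP; split.
  by apply/fsubsetP => v; rewrite !inE => /andP[].
move=> e eG; apply/negP => /fsubsetP sub.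
have nx := td_xi_node T eG; have /fsubsetP ex := td_xi_endpts T eG.
have := td_xi_intro T eG; have := HW.1 _ nx.
case: (subtree _ _) => // t /single_child_stepP Wx [eB _ _].
case: Wx => [[v]|[v]|[e' [e'G xe' _ /negP[]]]]; rewrite ?eB ?fsetDv ?inE //.
have {e'G xe'} -> : e' = e by apply: (@td_xi_inj _ T).
apply/fsubsetP => v ve.
have nc : child0 (td_xi T e) \in nodes (td_tree T).
  have := td_xi_intro T eG; rewrite child_nodes //; by case: subtree.
rewrite witness_extracted //; first exact: sub.
by rewrite -eB; apply: ex.
Qed.

(** Bounds the size of a table by the number of subsets of the bag. *)
Lemma indset_Gamma_sub t u : u \in nodes (td_tree T) ->
  subtree (td_tree T) u = t ->
  Gamma_rec D T t u `<=` [fset enc X | X in fpowerset (B u)].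
Proof.
elim: t u => [|t IH|t1 IH1 t2 IH2] u un ut; apply/fsubsetP => w /=.
- rewrite inE => /eqP ->; apply/imfsetP; exists fset0 => //=.
  by rewrite fpowersetE fsub0set.
- have nc : child0 u \in nodes (td_tree T) by rewrite child_nodes // ut.
  have sc : subtree (td_tree T) (child0 u) = t by rewrite subtree_rcons // ut /= subtree_nil.
  have := td_nodes un; rewrite ut => hB.
  case/bigfcupP => x; rewrite andbT => /(fsubsetP (IH _ nc sc)).
  case/imfsetP => X /=; rewrite fpowersetE => XB -> /single_child_stepP.
  (* If the bag does not shrink, old subsets remain subsets; otherwise the node must forget a
     vertex. *)
  have [sub|nsub] := boolP (B (child0 u) `<=` B u).
    have XBu := fsubset_trans XB sub; rewrite encK.
    case=> [[v]|[v _ ->]|[e [_ _ -> _]]].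
    + rewrite inE => /andP[_ vB]; rewrite !inE => /orP[] /eqP ->; apply/imfsetP.
        by exists X => //=; rewrite fpowersetE.
      by exists (v |` X) => //=; rewrite fpowersetE fsubUset XBu fsub1set vB.
    + apply/imfsetP; exists (X `\ v) => //=; rewrite fpowersetE.
      exact: fsubset_trans (fsubD1set _ _) XBu.
    + by apply/imfsetP; exists X => //=; rewrite fpowersetE.
  have {hB} [v0 /andP[sub /eqP eD]] : exists v, forget_vertex_node B u v.
    case: hB => [[v [sub _]]||[e [eB _ _]]] //; first by rewrite sub in nsub.
    by rewrite eB fsubset_refl in nsub.
  case=> [[v]|[v]|[e [eG xe _ _]]].
  + by rewrite inE => /andP[vc /(fsubsetP sub)]; rewrite (negPf vc).
  + rewrite eD inE => /eqP -> ->; rewrite encK.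
    apply/imfsetP; exists (X `\ v0) => //=; rewrite fpowersetE.
    apply/fsubsetP => y; rewrite !inE => /andP[xv /(fsubsetP XB) xc].
    by move/fsetP/(_ y): eD; rewrite !inE xc andbT (negPf xv) => /negbFE.
  + have := td_xi_intro T eG; rewrite xe ut => -[eB _ _].
    by rewrite eB fsubset_refl in nsub.
- have nc : child0 u \in nodes (td_tree T) by rewrite child_nodes // ut.
  have sc : subtree (td_tree T) (child0 u) = t1.
    by rewrite subtree_rcons // ut /= subtree_nil.
  have := td_nodes un; rewrite ut => -[eB _].
  case/bigfcupP => x; rewrite andbT => /(fsubsetP (IH1 _ nc sc)) xB.
  case/bigfcupP => y _ /=; case: ifP => // _; rewrite inE => /eqP ->.
  by rewrite eB.
Qed.

End Correctness.

Lemma indset_preserving : solution_preserving indset_core independent_set.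
Proof.
exists (fun v w => v \in dec w) => G T _; split=> [W|X ind].
  exact: witness_independent.
by exists (fun u => enc (X `&` td_bag T u));
  [exact: trace_witness|exact: trace_extracted].
Qed.

Lemma indset_solves : dp_solves indset_core independent_set.
Proof.
move=> G T; split=> _; last exact: indset_accepts.
by exists fset0; exact: independent0.
Qed.

Lemma indset_table : table_complexity indset_core (fun k _ => 2 ^ k.+1).
Proof.
move=> k G T wk u un.
apply: leq_trans (fsubset_leq_card (indset_Gamma_sub un erefl)) _.
rewrite (leq_trans (leq_imfset_card _ _ _)) // card_fpowerset leq_exp2l //.
have h : #|` td_bag T u| <= \max_(w <- td_nodes_of T) #|` td_bag T w|.
  exact: leq_bigmax_seq.
apply: leq_trans h _.
by rewrite /width lerBlDr -PoszD lez_nat addn1 in wk.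
Qed.

End IndependentSet.

(** * Path decompositions from lists of steps *)

Section PathDecomposition.
Local Open Scope nat_scope.
Local Open Scope fset_scope.
Variable G : graph.

(* A step towards the root: [(Some true, v)] introduces the vertex [v],
   [(Some false, v)] forgets it and [(None, e)] introduces the edge [e].  The
   head of a list of steps is performed last, hence sits at the root. *)
Definition td_step := (option bool * nat)%type.

Fixpoint bag (s : seq td_step) : {fset nat} :=
  match s with
  | [::] => fset0
  | (Some true, v) :: s' => v |` bag s'
  | (Some false, v) :: s' => bag s' `\ v
  | (None, _) :: s' => bag s'
  end.

(** Forbidding repeated steps prevents a forgotten vertex from returning, which makes the bags
    connected, and lets [index] recover the node introducing an edge. *)
Fixpoint valid (s : seq td_step) : bool :=
  if s is x :: s' then
    [&& valid s', x \notin s' &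
      match x with
      | (Some true, v) => v \in gV G
      | (Some false, v) => v \in bag s'
      | (None, e) => (e \in gE G) && (endpts G e `<=` bag s')
      end]
  else true.

Lemma bag_intro s v : v \in bag s -> (Some true, v) \in s.
Proof.
elim: s => [|[[[]|] w] s IH] //=; rewrite !inE.
- by case/orP => [/eqP ->|/IH ->]; rewrite ?eqxx ?orbT.
- by case/andP => _ /IH ->; rewrite orbT.
Qed.

Lemma valid_drop j s : valid s -> valid (drop j s).
Proof.
elim: s j => [|x s IH] [|j] //= /and3P[vs _ _]; exact: IH.
Qed.

Lemma valid_uniq s : valid s -> uniq s.
Proof. by elim: s => [|x s IH] //= /and3P[/IH -> ->]. Qed.

Lemma bag_sub s : valid s -> bag s `<=` gV G.
Proof.
elim: s => [|[[[]|] w] s IH] //= /and3P[/IH sub _ h].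
- by rewrite fsubUset sub fsub1set h.
- exact: fsubset_trans (fsubD1set _ _) sub.
- exact: sub.
Qed.

Lemma forgotten_notin s v : valid s -> (Some false, v) \in s -> v \notin bag s.
Proof.
elim: s => [|x s IH] //= /and3P[vs xs hx]; rewrite inE.
case: eqP => [<- _|_ /= vin]; first by rewrite !inE eqxx.
have vb := IH vs vin.
have vi : (Some true, v) \in s.
  elim: s vs vin {IH xs hx vb} => [|y s IH] //= /and3P[vs ys hy]; rewrite !inE.
  case/orP=> [/eqP ey|/(IH vs) ->]; last by rewrite orbT.
  by rewrite -ey in hy; rewrite bag_intro ?orbT.
case: x xs {hx} => [[[]|] w] ws //=; rewrite !inE ?(negPf vb) ?andbF ?orbF //.
by apply: contra ws => /eqP <-.
Qed.

(** If [v] were absent in between, it would have to be introduced a second time. *)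
Lemma bag_interval s v j k : valid s -> j <= k ->
  v \in bag s -> v \in bag (drop k s) -> v \in bag (drop j s).
Proof.
elim: s j k => [|x s IH] [|j] [|k] //= /and3P[vs xs _] jk vx vk.
have [vb|vb] := boolP (v \in bag s); first exact: IH vb vk.
have vi : (Some true, v) \in s by apply: mem_drop (bag_intro vk).
case: x xs vx => [[[]|] w] ws /=; rewrite ?inE ?(negPf vb) ?andbF ?orbF //.
by move=> /eqP e; rewrite -e vi in ws.
Qed.

Fixpoint line (n : nat) : tree := if n is n'.+1 then TOne (line n') else TLeaf.

Lemma nodes_line n u :
  (u \in nodes (line n)) = (u == nseq (size u) false) && (size u <= n).
Proof.
elim: n u => [|n IH] [|x u] //=; rewrite !inE //= eqseq_cons; first by rewrite andbF.
case: x => /=; first by apply/negbTE/negP => /mapP[z _ []].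
by rewrite mem_map ?IH // => ? ? [].
Qed.

Lemma subtree_line n i : i <= n -> subtree (line n) (nseq i false) = line (n - i).
Proof. by elim: n i => [|n IH] [|i] //= /IH. Qed.

Lemma child_nseq i : child0 (nseq i false) = nseq i.+1 false.
Proof. by rewrite /child0 -cats1 -[[:: false]]/(nseq 1 false) -nseqD addn1. Qed.

Lemma line_path n (P : pred nat) i d : i + d <= n ->
  (forall j, i <= j <= i + d -> P j) ->
  (exists p, [/\ path tree_adj (nseq i false) p,
     last (nseq i false) p = nseq (i + d) false &
     forall x, x \in p -> x \in nodes (line n) /\ P (size x)]) /\
  (exists p, [/\ path tree_adj (nseq (i + d) false) p,
     last (nseq (i + d) false) p = nseq i false &
     forall x, x \in p -> x \in nodes (line n) /\ P (size x)]).
Proof.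
elim: d i => [|d IH] i idn Pj.
  by rewrite addn0; split; exists [::].
rewrite addnS -addSn in idn Pj *.
have [|[p [pp lp hp]] [q [pq lq hq]]] := IH _ idn.
  by move=> j /andP[ij jd]; apply: Pj; rewrite ltnW.
split.
  exists (nseq i.+1 false :: p); split => //.
    by rewrite /= -/(nseq i.+1 false) pp andbT /tree_adj child_nseq eqxx.
  move=> x; rewrite inE => /orP[/eqP ->|]; last exact: hp.
  rewrite nodes_line size_nseq eqxx (leq_trans _ idn) ?leq_addr //.
  by split=> //; apply: Pj; rewrite leqnSn leq_addr.
exists (rcons q (nseq i false)); split.
- by rewrite rcons_path pq lq /tree_adj !child_nseq eqxx !orbT.
- by rewrite last_rcons.
move=> x; rewrite mem_rcons inE => /orP[/eqP ->|]; last exact: hq.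
rewrite nodes_line size_nseq eqxx (leq_trans _ idn) ?(leq_trans (leqnSn i)) ?leq_addr //.
by split=> //; apply: Pj; rewrite leqnn (leq_trans (leqnSn i)) ?leq_addr.
Qed.

(** The node at depth [i] of a line performs step [i] of [s] and carries the bag of the suffix
    [drop i s]; the leaf corresponds to the empty suffix. *)
Lemma path_td s : valid s -> bag s = fset0 ->
  (forall v, v \in gV G -> (Some true, v) \in s) ->
  (forall e, e \in gE G -> (None, e) \in s) ->
  exists T : nice_td G, td_tree T = line (size s) /\
    td_bag T = fun u => bag (drop (size u) s).
Proof.
move=> vs b0 allV allE.
pose tr := line (size s); pose B (u : node) := bag (drop (size u) s).
pose xi e : node := nseq (index (None, e) s) false.
have dropE i : i < size s ->
    drop i s = nth (None, 0) s i :: drop i.+1 s by apply: drop_nth.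
have xi_lt e : e \in gE G -> index (None, e) s < size s.
  by move=> eG; rewrite index_mem allE.
have xi_drop e : e \in gE G ->
    drop (index (None, e) s) s = (None, e) :: drop (index (None, e) s).+1 s.
  by move=> eG; rewrite dropE ?xi_lt // nth_index // allE.
have xi_edge e : e \in gE G -> intro_edge_node G B xi (xi e) e.
  move=> eG; split=> //; rewrite /B /xi child_nseq !size_nseq.
  by rewrite xi_drop.
have xi_node e : e \in gE G -> xi e \in nodes tr.
  by move=> eG; rewrite nodes_line size_nseq eqxx ltnW ?xi_lt.
unshelve eexists (@NiceTD G tr B xi _ _ _ _ _ _ _ _ _) => //.
- by move=> u _; apply/bag_sub/valid_drop.
- move=> v vG; have vin := allV _ vG; have lt := vin; rewrite -index_mem in lt.
  exists (nseq (index (Some true, v) s) false).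
    by rewrite nodes_line size_nseq eqxx ltnW.
  by rewrite /B size_nseq dropE // nth_index //= !inE eqxx.
- move=> v u w; rewrite !nodes_line => /andP[/eqP eu su] /andP[/eqP ew sw] vu vw.
  have bt i k j : v \in bag (drop i s) -> v \in bag (drop k s) ->
      i <= j <= k -> v \in bag (drop j s).
    move=> vi vk /andP[ij jk].
    have := @bag_interval (drop i s) v (j - i) (k - i) (valid_drop i vs).
    by rewrite !drop_drop !subnK ?(leq_trans ij jk) //; apply; rewrite ?leq_sub2r.
  pose P j := v \in bag (drop j s).
  have [uw|/ltnW wu] := leqP (size u) (size w).
    have [||[p [p1 p2 p3]] _] := @line_path (size s) P (size u) (size w - size u).
    + by rewrite subnKC.
    + by move=> j; rewrite subnKC //; apply: bt.
    by exists p; rewrite subnKC // in p2; rewrite eu ew.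
  have [||_ [p [p1 p2 p3]]] := @line_path (size s) P (size w) (size u - size w).
  + by rewrite subnKC.
  + by move=> j; rewrite subnKC //; apply: bt.
  by exists p; rewrite subnKC // in p1 p2; rewrite eu ew.
- move=> e f eG fG /(congr1 size); rewrite !size_nseq => ef.
  have := nth_index (None, 0) (allE _ eG); rewrite ef nth_index ?allE //.
  by case.
- move=> e eG; have := valid_drop (index (None, e) s) vs.
  rewrite xi_drop //= => /and3P[_ _ /andP[_ sub]].
  by rewrite /B /xi size_nseq xi_drop.
- move=> e eG; have lt := xi_lt e eG.
  have -> : subtree tr (xi e) = line (size s - index (None, e) s).
    exact: subtree_line (ltnW lt).
  move: lt; rewrite -subn_gt0; case: (size s - _) => // d _.
  exact: xi_edge.
- by rewrite /B drop0.
- move=> u; rewrite nodes_line => /andP[/eqP eu su]; rewrite eu /tr subtree_line //.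
  set i := size u in su *.
  case: ltngtP su => // [iS _|iS _]; last by rewrite iS subnn /= /B size_nseq drop_size.
  have := iS; rewrite -subn_gt0; case: (size s - i) => // d _.
  change (line d.+1) with (TOne (line d)).
  have Bu : B (nseq i false) = bag (nth (None, 0) s i :: drop i.+1 s).
    by rewrite /B size_nseq dropE.
  have Bc : B (child0 (nseq i false)) = bag (drop i.+1 s).
    by rewrite /B child_nseq size_nseq.
  have := valid_drop i vs; rewrite (dropE i iS) /=.
  have nthi := index_uniq (None, 0) iS (valid_uniq vs).
  case: (nth _ s i) nthi Bu => [[[]|] v] nthi Bu /and3P[_ ns hx].
  + constructor 1; exists v; rewrite /intro_vertex_node Bu Bc /=.
    have vn : v \notin bag (drop i.+1 s) by apply: contra ns; apply: bag_intro.
    split; first exact: fsubsetUr.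
    by apply/fsetP => z; rewrite !inE; case: eqVneq => [->|_] /=; rewrite ?vn ?andNb.
  + constructor 2; exists v; rewrite /forget_vertex_node Bu Bc /= fsubD1set /=.
    apply/eqP/fsetP => z; rewrite !inE.
    by case: eqVneq => [->|_] /=; rewrite ?hx ?andNb.
  + by constructor 3; exists v; have /andP[/xi_edge] := hx; rewrite /xi nthi.
Qed.

(** A partial construction: current bag [b], vertices [Vs] introduced so far, edges satisfying [P]
    already introduced, and no bag larger than [w]. *)
Definition reach (w : nat) (b Vs : {fset nat}) (P : pred nat) : Prop :=
  exists s, [/\ valid s, bag s = b,
    forall v, ((Some true, v) \in s) = (v \in Vs),
    forall e, e \in gE G -> P e -> (None, e) \in s &
    forall j, #|` bag (drop j s)| <= w].

Lemma reach_intro w b Vs P v : reach w b Vs P -> v \in gV G -> v \notin Vs ->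
  #|` b| < w -> reach w (v |` b) (v |` Vs) P.
Proof.
move=> [s [vs sb sV sE sw]] vG vV bw; exists ((Some true, v) :: s); split=> /=.
- by rewrite vs vG sV vV.
- by rewrite sb.
- by move=> x; rewrite !inE sV.
- by move=> e eG Pe; rewrite inE sE ?orbT.
- case=> [|j] //=; rewrite sb (leq_trans _ bw) // cardfsU1.
  by rewrite -add1n leq_add2r leq_b1.
Qed.

Lemma reach_forget w b Vs P v : reach w b Vs P -> v \in b ->
  reach w (b `\ v) Vs P.
Proof.
move=> [s [vs sb sV sE sw]] vb; exists ((Some false, v) :: s); split=> /=.
- by rewrite vs sb vb andbT; apply: contraL vb => /(forgotten_notin vs); rewrite sb.
- by rewrite sb.
- by move=> x; rewrite !inE sV.
- by move=> e eG Pe; rewrite inE sE ?orbT.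
- case=> [|j] //=; have := sw 0; rewrite drop0; apply: leq_trans.
  exact: fsubset_leq_card (fsubD1set _ _).
Qed.

Lemma reach_edges w b Vs P : reach w b Vs P ->
  reach w b Vs (fun e => P e || (endpts G e `<=` b)).
Proof.
move=> Hr; have : forall l : seq nat, {subset l <= gE G} ->
    reach w b Vs (fun e => P e || (e \in l) && (endpts G e `<=` b)).
  elim=> [|e l IH] lG.
    by case: Hr => s [vs sb sV sE sw]; exists s; split=> // e eG;
      rewrite in_nil orbF; apply: sE.
  have [|s [vs sb sV sE sw]] := IH.
    by move=> x xl; apply: lG; rewrite inE xl orbT.
  have [h|h] := boolP (((None, e) \notin s) && (endpts G e `<=` b)); last first.
    exists s; split=> // f fG /orP[Pf|]; first by apply: sE => //; rewrite Pf.
    rewrite inE => /andP[/orP[/eqP ->|fl] fb]; last first.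
      by apply: sE => //; rewrite fl fb orbT.
    by move: h; rewrite negb_and negbK => /orP[//|/negP].
  have eG : e \in gE G by apply: lG; rewrite inE eqxx.
  case/andP: h => es eb; exists ((None, e) :: s); split=> /=.
  - by rewrite vs es eG sb eb.
  - by rewrite sb.
  - by move=> x; rewrite inE sV.
  - move=> f fG; rewrite !inE => h; case: eqVneq => [//|ef] /=.
    have fe : (f == e) = false.
      by apply/negP => /eqP fe; move: ef; rewrite fe eqxx.
    by apply: sE => //; rewrite fe in h.
  - by case=> [|j] //=; have := sw 0; rewrite drop0.
move=> /(_ (gE G) (fun _ => id)) [s [vs sb sV sE sw]].
by exists s; split=> // e eG h; apply: sE => //; rewrite eG.
Qed.

Lemma reach_intros w (l : seq nat) b Vs P : reach w b Vs P ->
  uniq l -> {subset l <= gV G} -> (forall v, v \in l -> v \notin Vs) ->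
  #|` b| + size l <= w -> reach w ([fset v in l] `|` b) ([fset v in l] `|` Vs) P.
Proof.
move=> Hr; elim: l => [|v l IH] /=.
  move=> _ _ _ _.
  have -> : [fset v in [::]] = fset0 :> {fset nat} by apply/fsetP => x; rewrite !inE.
  by rewrite !fset0U.
move=> /andP[vl ul] lG lV; rewrite addnS => bw.
have cons A : [fset x in v :: l] `|` A = v |` ([fset x in l] `|` A) :> {fset nat}.
  by apply/fsetP => x; rewrite !inE orbA.
rewrite !cons; apply: reach_intro.
- apply: IH => // [x xl|x xl|]; last exact: ltnW.
    by apply: lG; rewrite inE xl orbT.
  by apply: lV; rewrite inE xl orbT.
- by apply: lG; rewrite inE eqxx.
- by rewrite !inE (negPf vl) /= lV // inE eqxx.
apply: leq_ltn_trans bw.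
rewrite cardfsU (leq_trans (leq_subr _ _)) // addnC leq_add2l.
by rewrite card_fseq size_undup.
Qed.

Lemma reach_forgets w b Vs P : reach w b Vs P -> reach w fset0 Vs P.
Proof.
move: {2}(#|` b|) (leqnn #|` b|) => n; elim: n b => [|n IH] b bn Hr.
  by move: bn; rewrite leqn0 cardfs_eq0 => /eqP <-.
have [/eqP <-//|/fset0Pn[v vb]] := boolP (b == fset0).
apply: (IH (b `\ v)); last exact: reach_forget.
by rewrite (cardfsD1 v) vb in bn.
Qed.

(* Keep [C] in every bag and process the other vertices one at a time. *)
Lemma vertex_cover_td (C : {fset nat}) : C `<=` gV G ->
  (forall e, e \in gE G -> exists2 r, r \in gV G & endpts G e `<=` r |` C) ->
  exists T : nice_td G, \max_(u <- td_nodes_of T) #|` td_bag T u| <= #|` C|.+1.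
Proof.
move=> CV eC; set w := #|` C|.+1.
have H0 : reach w fset0 fset0 pred0.
  by exists [::]; split=> // j; rewrite cardfs0.
have HC : reach w C C (fun e => endpts G e `<=` C).
  have : reach w C C pred0.
    have := @reach_intros w C fset0 fset0 pred0 H0 (fset_uniq C) (fsubsetP CV).
    rewrite (_ : _ `|` fset0 = C); first by apply; rewrite // cardfs0 add0n.
    by apply/fsetP => x; rewrite !inE orbF.
  exact: reach_edges.
(* Each [r] is introduced on top of [C], the edges inside the bag are added, and [r] is forgotten,
   so the bag is [C] again before the next vertex. *)
have Hl : forall l : seq nat, uniq l -> {subset l <= gV G} ->
    (forall v, v \in l -> v \notin C) ->
    reach w C ([fset v in l] `|` C)
      (fun e => (endpts G e `<=` C) || has (fun r => endpts G e `<=` r |` C) l).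
  elim=> [|r l IH] /=.
    move=> _ _ _.
    have -> : [fset v in [::]] = fset0 :> {fset nat} by apply/fsetP => x; rewrite !inE.
    rewrite fset0U; case: HC => s [vs sb sV sE sw]; exists s; split=> // e eG.
    by rewrite orbF; apply: sE.
  move=> /andP[rl ul] lG lC.
  have {}IH := IH ul (fun x xl => lG x (mem_behead (s := r :: l) xl))
    (fun x xl => lC x (mem_behead (s := r :: l) xl)).
  have rC := lC r (mem_head _ _).
  have rV : r \notin [fset v in l] `|` C by rewrite !inE negb_or rl.
  have H1 := reach_edges (reach_intro IH (lG r (mem_head _ _)) rV (leqnn _)).
  have [s [vs sb sV sE sw]] := reach_forget H1 (fset1U1 r C).
  rewrite fsetU1K // in sb.
  exists s; split=> // [v|e eG h].
    by rewrite sV !inE orbA.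
  apply: sE => //; move: h; case: (_ `<=` C) => //=.
  by rewrite orbC.
have [|||s [vs sb sV sE sw]] := @reach_forgets w C _ _ (Hl (enum_fset (gV G `\` C)) _ _ _).
- exact: fset_uniq.
- by move=> x; rewrite inE => /andP[].
- by move=> x; rewrite inE => /andP[].
have [//|//|||T [trT bT]] := @path_td s.
- move=> v vG; rewrite sV !inE vG andbT.
  by case: (v \in C).
- move=> e eG; apply: sE => //; have [r rG er] := eC e eG.
  have [rC|rC] := boolP (r \in C).
    by rewrite (fsetUidPr _ _ _) ?fsub1set // in er; rewrite er.
  by apply/orP; right; apply/hasP; exists r => //; rewrite inE rC rG.
exists T; apply/bigmax_leqP_seq => u _ _; rewrite bT; exact: sw.
Qed.

End PathDecomposition.

(** * Graphs from relations on finite types *)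

Section FiniteGraph.
Local Open Scope nat_scope.
Local Open Scope fset_scope.
Variables (T : finType) (adj : rel T).

Definition vtx (x : T) : nat := choice.pickle x.
(** Edges are numbered by ordered pairs, so distinct vertices related in both directions are joined
    by two parallel edges. *)
Definition edg (p : T * T) : nat := choice.pickle p.
Local Notation adjp := [pred p : T * T | adj p.1 p.2].
Definition fg_V : {fset nat} := [fset vtx x | x in T].
Definition fg_E : {fset nat} := [fset edg p | p in adjp].
Definition fg_inc : {fset nat * nat} :=
  [fset (edg p, vtx p.1) | p in adjp] `|` [fset (edg p, vtx p.2) | p in adjp].

Lemma vtx_inj : injective vtx. Proof. exact: (pcan_inj choice.pickleK). Qed.
Lemma edg_inj : injective edg. Proof. exact: (pcan_inj choice.pickleK). Qed.

Lemma vtx_in x : vtx x \in fg_V.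
Proof. by apply/imfsetP; exists x. Qed.

Lemma fg_inc_sub : fg_inc `<=` fg_E `*` fg_V.
Proof.
by apply/fsubsetP => -[e v]; rewrite !inE /= => /orP[] /imfsetP[p pP [-> ->]];
  rewrite vtx_in andbT; apply/imfsetP; exists p.
Qed.

Lemma fg_endpts x y : adj x y ->
  endpts_of fg_inc fg_V (edg (x, y)) = [fset vtx x; vtx y].
Proof.
move=> xy; apply/fsetP => v; rewrite !inE /=; apply/andP/orP => [[_]|].
  by case/orP => /imfsetP[p pP [/edg_inj <- ->]]; [left|right].
case=> /eqP ->; rewrite vtx_in; split=> //; apply/orP.
  by left; apply/imfsetP; exists (x, y).
by right; apply/imfsetP; exists (x, y).
Qed.

Lemma fg_endptsP e : e \in fg_E ->
  exists v v', endpts_of fg_inc fg_V e = [fset v; v'].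
Proof.
by case/imfsetP => -[x y] /= xy ->; exists (vtx x), (vtx y); apply: fg_endpts.
Qed.

Definition fgraph_of : graph := Graph fg_inc_sub fg_endptsP.

Lemma card_fgraph : #|` gV fgraph_of| = #|T|.
Proof. rewrite card_imfset ?cardE //; exact: vtx_inj. Qed.

Lemma fgraph_edge x y : adj x y ->
  edg (x, y) \in gE fgraph_of /\
  endpts fgraph_of (edg (x, y)) = [fset vtx x; vtx y].
Proof. by move=> xy; split; [apply/imfsetP; exists (x, y)|exact: fg_endpts]. Qed.

Lemma fgraph_edgeP e : e \in gE fgraph_of ->
  exists x y, adj x y /\ endpts fgraph_of e = [fset vtx x; vtx y].
Proof.
by case/imfsetP => -[x y] /= xy ->; exists x, y; split=> //; apply: fg_endpts.
Qed.

Definition vset (p : pred T) : {fset nat} := [fset vtx x | x in p].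

Lemma in_vset p x : (vtx x \in vset p) = p x.
Proof. by rewrite mem_imfset //=; exact: vtx_inj. Qed.

Lemma vset_sub p : vset p `<=` gV fgraph_of.
Proof. by apply/fsubsetP => _ /imfsetP[x _ ->]; exact: vtx_in. Qed.

Lemma card_vset p : #|` vset p| = #|p|.
Proof. rewrite card_imfset ?cardE //; exact: vtx_inj. Qed.

Lemma independent_vset p : (forall x y, adj x y -> ~~ (p x && p y)) ->
  independent fgraph_of (vset p).
Proof.
move=> h; apply/independentP; split=> [|e /fgraph_edgeP[x [y [xy ->]]]].
  exact: vset_sub.
by rewrite fsubUset !fsub1set !in_vset; apply: h.
Qed.

Lemma independent_adj X x y : independent fgraph_of X -> adj x y ->
  ~~ ((vtx x \in X) && (vtx y \in X)).
Proof.
move=> /independentP[_ ind] /fgraph_edge[eG ee].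
by have := ind _ eG; rewrite ee fsubUset !fsub1set.
Qed.

End FiniteGraph.

(** * The hard graph and its treewidth *)

Section HardGraph.
Local Open Scope nat_scope.
Variable m : nat.

Definition hvert := (('I_m + 'I_m) + ('I_m + 'I_m * 'I_m))%type.
Definition hU (i : 'I_m) : hvert := inl (inl i).
Definition hN (i : 'I_m) : hvert := inl (inr i).
Definition hK (i : 'I_m) : hvert := inr (inl i).
Definition hR (i j : 'I_m) : hvert := inr (inr (i, j)).

(* [hU i] and [hN i] stand for a bit and its negation and [hR i j] for the
   conjunction of bit i and the negation of bit j; the clique of the [hK i]
   only serves to make the treewidth large. *)
Definition hadj (x y : hvert) : bool :=
  match x, y with
  | inl (inl i), inl (inr j) => i == j
  | inr (inr (i, _)), inl (inr i') => i == i'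
  | inr (inr (_, j)), inl (inl j') => j == j'
  | inr (inl i), inr (inl j) => i != j
  | _, _ => false
  end.

Definition hgraph : graph := fgraph_of hadj.

Lemma card_hgraph : #|` gV hgraph| = m ^ 2 + 3 * m.
Proof. by rewrite card_fgraph !card_sum !card_prod !card_ord; lia. Qed.

(** No two [hR] vertices are adjacent, so the remaining [3 * m] vertices form a vertex cover. *)
Lemma hgraph_td :
  exists T : nice_td hgraph,
    \max_(u <- td_nodes_of T) #|` td_bag T u| <= (3 * m).+1.
Proof.
pose core (x : hvert) := if x is inr (inr _) then false else true.
have cC : #|core| <= 3 * m.
  pose f (x : ('I_m + 'I_m) + 'I_m) : hvert :=
    match x with inl y => inl y | inr i => hK i end.
  apply: (@leq_trans #|codom f|).
    apply/subset_leq_card/fintype.subsetP => -[y|[i|p]] // _; apply/codomP.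
      by exists (inl y).
    by exists (inr i).
  apply: leq_trans (card_size _) _.
  by rewrite size_codom !card_sum !card_ord; lia.
have [|e /fgraph_edgeP[x [y [xy ->]]]|T hT] :=
    @vertex_cover_td hgraph (vset core).
- exact: vset_sub.
- have sub2 r z : core z -> ([fset vtx r; vtx z] `<=` vtx r |` vset core)%fset.
    move=> cz; apply/fsubsetP => v; rewrite !inE => /orP[->//|/eqP ->].
    by rewrite in_vset cz orbT.
  case: x xy => [x|x] xy.
    exists (vtx y); first exact: vtx_in.
    by rewrite fsetUC; apply: sub2.
  exists (vtx (inr x : hvert)); first exact: vtx_in.
  by apply: sub2; case: x y xy => [i|[i j]] [[]|[]].
exists T; apply: leq_trans hT _.
by rewrite card_vset ltnS.
Qed.

(** Each clique vertex has at least [m - 1] neighbours in the clique, so [min_degree_width]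
    applies. *)
Lemma hgraph_width (T : nice_td hgraph) : 0 < m ->
  m <= \max_(u <- td_nodes_of T) #|` td_bag T u|.
Proof.
move=> m0; pose S := vset (fun x : hvert => if x is inr (inl _) then true else false).
have SP v : v \in S -> exists i, v = vtx (hK i).
  by case/imfsetP => -[//|[i _ ->|//]]; exists i.
have hS i : vtx (hK i) \in S by rewrite in_vset.
have cS : m <= #|` S|.
  rewrite card_vset -[leqLHS]card_ord -(card_codom (f := hK)); last by move=> ? ? [].
  by apply/subset_leq_card/fintype.subsetP => x /codomP[i ->].
have := @min_degree_width hgraph T S (fun v => S `\ v)%fset m.-1.
rewrite prednK //; apply.
- by apply/fset0Pn; exists (vtx (hK (Ordinal m0))).
- exact: vset_sub.
- move=> v vS; rewrite fsubD1set !inE eqxx; split=> //.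
  by move: cS; rewrite (cardfsD1 v) vS; case: m.
- move=> v w /SP[i ->]; rewrite !inE => /andP[+ /SP[j wj]]; rewrite {}wj => ij.
  have ad : hadj (hK i) (hK j) by apply: contra ij => /eqP ->.
  have [eG ee] := fgraph_edge ad.
  by exists (edg (hK i, hK j)); rewrite // ee !inE !eqxx orbT.
Qed.

Lemma hgraph_treewidth : 0 < m ->
  exists k, [/\ treewidth hgraph k, m <= k.+1 & k <= 3 * m].
Proof.
move=> m0; pose W n := `[< exists T : nice_td hgraph,
  \max_(u <- td_nodes_of T) #|` td_bag T u| = n >].
have [T0 T0m] := hgraph_td.
have exW : exists n, W n by eexists; apply/asboolP; exists T0.
case: (ex_minnP exW) => n /asboolP[T Tn] minn.
have mn : m <= n by rewrite -Tn; apply: hgraph_width.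
have n0 : 0 < n := leq_trans m0 mn.
exists n.-1; split.
- split=> [|T']; first by exists T; rewrite /width Tn -(prednK n0) /= -addn1 PoszD addrK.
  rewrite /width lerBrDr -PoszD lez_nat addn1 prednK //; apply: minn.
  by apply/asboolP; exists T'.
- by rewrite prednK.
- rewrite -ltnS prednK //; apply: leq_trans T0m; apply: minn.
  by apply/asboolP; exists T0.
Qed.

End HardGraph.

(** * Lower bound on the extension complexity *)

Section LowerBound.
Variables (R : realType) (m : nat).
Local Notation G := (hgraph m).
Local Notation P := (@solution_polytope R independent_set G).

Definition hpt (y : hvert m) : gV G := [` (vtx_in y : vtx y \in gV G)]%fset.

Definition udisj_form (a : seq bool) (x : {ffun gV G -> R^o}) : R :=
  2 * (\sum_(i < m) (nth false a i)%:R * x (hpt (hU i))) +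
  \sum_(i < m) \sum_(j < m) (nth false a i)%:R * (nth false a j)%:R *
     (x (hpt (hN i)) + x (hpt (hR i j))).

Definition udisj_bound (a : seq bool) : R :=
  1 + (\sum_(i < m) (nth false a i)%:R) ^+ 2.

Lemma udisj_form_linear a k u v :
  udisj_form a (k *: u + v) = k * udisj_form a u + udisj_form a v.
Proof.
rewrite /udisj_form.
have -> : \sum_(i < m) (nth false a i)%:R * (k *: u + v) (hpt (hU i)) =
    k * (\sum_(i < m) (nth false a i)%:R * u (hpt (hU i))) +
    \sum_(i < m) (nth false a i)%:R * v (hpt (hU i)).
  rewrite mulr_sumr -big_split; apply: eq_bigr => i _ /=.
  by rewrite !ffunE /GRing.scale /=; ring.
set S := \sum_(i < m) \sum_(j < m) _.
have -> : S = k * (\sum_(i < m) \sum_(j < m) (nth false a i)%:R *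
     (nth false a j)%:R * (u (hpt (hN i)) + u (hpt (hR i j)))) +
   \sum_(i < m) \sum_(j < m) (nth false a i)%:R * (nth false a j)%:R *
     (v (hpt (hN i)) + v (hpt (hR i j))).
  rewrite mulr_sumr -big_split; apply: eq_bigr => i _ /=.
  rewrite mulr_sumr -big_split; apply: eq_bigr => j _ /=.
  by rewrite !ffunE /GRing.scale /=; ring.
by ring.
Qed.

Lemma indicator_hpt X y : indicator R (gV G) X (hpt y) = (vtx y \in X)%:R.
Proof. by rewrite ffunE. Qed.

(** Turns the pair terms into a difference of squares, so that the linear part of the form completes
    $(s-1)^2$, where $s$ is the sum of the [al i * be i]. *)
Lemma sum_pairs (al be : 'I_m -> R) :
  \sum_i \sum_j al i * al j * (1 - be i * be j) =
  (\sum_i al i) ^+ 2 - (\sum_i al i * be i) ^+ 2.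
Proof.
rewrite !expr2 !big_distrlr /= -sumrB; apply: eq_bigr => i _.
by rewrite -sumrB; apply: eq_bigr => j _; ring.
Qed.

(** On indicator vectors the three edges among $u_i, n_i, r_{ij}, u_j$ give $n_i + r_{ij} \le 1 -
    u_i u_j$; the rest is nonnegativity of a square. *)
Lemma udisj_form_le a x : P x -> udisj_form a x <= udisj_bound a.
Proof.
apply: convex_hull_le; first exact: udisj_form_linear.
move=> _ [X indX <-]; rewrite /udisj_form /udisj_bound.
pose al (i : 'I_m) : R := (nth false a i)%:R.
pose be i : R := indicator R (gV G) X (hpt (hU i)).
have le2 : \sum_(i < m) \sum_(j < m) al i * al j *
     (indicator R (gV G) X (hpt (hN i)) + indicator R (gV G) X (hpt (hR i j))) <=
   \sum_(i < m) \sum_(j < m) al i * al j * (1 - be i * be j).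
  apply: ler_sum => i _; apply: ler_sum => j _.
  apply: ler_wpM2l; first by rewrite -natrM ler0n.
  rewrite /be !indicator_hpt.
  have h1 := independent_adj indX (eqxx i : hadj (hU i) (hN i)).
  have h2 := independent_adj indX (eqxx i : hadj (hR i j) (hN i)).
  have h3 := independent_adj indX (eqxx j : hadj (hR i j) (hU j)).
  move: h1 h2 h3; case: (vtx (hU i) \in X); case: (vtx (hU j) \in X);
  case: (vtx (hN i) \in X); case: (vtx (hR i j) \in X) => //= _ _ _; lra.
rewrite sum_pairs in le2.
have := sqr_ge0 (\sum_i al i * be i - 1); rewrite sqrrB1.
by rewrite -/al -/be; move: le2; rewrite /al /be; lra.
Qed.

Definition bits_solution (b : seq bool) : pred (hvert m) := fun y =>
  match y with
  | inl (inl i) => nth false b i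
  | inl (inr i) => ~~ nth false b i
  | inr (inl _) => false
  | inr (inr (i, j)) => nth false b i && ~~ nth false b j
  end.

Definition bits_point (b : seq bool) : {ffun gV G -> R^o} :=
  indicator R (gV G) (vset (bits_solution b)).

Lemma bits_point_in b : P (bits_point b).
Proof.
apply: sub_convex_hull; exists (vset (bits_solution b)) => //.
apply: independent_vset => -[[i|i]|[i|[i i']]] [[j|j]|[j|[j j']]] //= /eqP ->;
  by case: nth => //=; rewrite ?andbF //; case: nth.
Qed.

(** Here the pairwise estimate is an equality: $(1-b_i) + b_i(1-b_j) = 1 - b_i b_j$. *)
Lemma udisj_form_bits a b :
  udisj_form a (bits_point b) = udisj_bound a - ((common m a b)%:R - 1) ^+ 2.
Proof.
rewrite /udisj_form /udisj_bound.
pose al (i : 'I_m) : R := (nth false a i)%:R.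
pose be (i : 'I_m) : R := (nth false b i)%:R.
have -> : (common m a b)%:R = \sum_i al i * be i :> R.
  by rewrite /common natr_sum; apply: eq_bigr => i _; rewrite -mulnb natrM.
have -> : \sum_(i < m) (nth false a i)%:R * bits_point b (hpt (hU i)) =
    \sum_i al i * be i.
  by apply: eq_bigr => i _; rewrite indicator_hpt in_vset.
have -> : \sum_(i < m) \sum_(j < m) (nth false a i)%:R * (nth false a j)%:R *
     (bits_point b (hpt (hN i)) + bits_point b (hpt (hR i j))) =
   \sum_(i < m) \sum_(j < m) al i * al j * (1 - be i * be j).
  apply: eq_bigr => i _; apply: eq_bigr => j _; congr (_ * _).
  rewrite !indicator_hpt !in_vset /= /be.
  by case: (nth _ b i); case: (nth _ b j) => /=; ring.
by rewrite sum_pairs sqrrB1; ring.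
Qed.

Lemma udisj_form_bits_lt a b :
  (udisj_form a (bits_point b) < udisj_bound a) = (common m a b != 1%N).
Proof.
rewrite udisj_form_bits ltrBlDr ltrDl exprn_even_gt0 //=.
by rewrite subr_eq0 pnatr_eq1.
Qed.

Lemma hgraph_extension r : has_extension P r -> (3 ^ m <= r.+1 * 2 ^ m)%N.
Proof.
(* For the empty set the form is identically 0 and never reaches its bound 1. So [I] keeps the
   nonempty sets, and the empty one gets the extra rectangle [None], whence [r.+1]. *)
move=> ext; pose I := {a : seq bool | [exists i : 'I_m, nth false a i]}.
have [||a|A [B AB]] := @extension_rect_cover R _ P r I (seq bool)
    (fun a => udisj_form (val a)) (fun a => udisj_bound (val a))
    bits_point ext _ _ _ bits_point_in.
- by move=> a k u v; apply: udisj_form_linear.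
- by move=> a x; apply: udisj_form_le.
- have /existsP[i ai] := valP a.
  (* A singleton inside [a] meets it in exactly one element, so the slack is 0. *)
  exists (bits_point (mkseq (fun j => j == i) m)); first exact: bits_point_in.
  rewrite udisj_form_bits (_ : common _ _ _ = 1%N) ?subrr ?expr0n ?subr0 //.
  rewrite /common (bigD1 i) //= ai nth_mkseq // eqxx big1 // => j ji.
  by rewrite nth_mkseq // (inj_eq val_inj) (negPf ji) andbF.
pose A' (o : option 'I_r) : pred (seq bool) := fun a =>
  if o is Some i then `[< exists2 x : I, val x = a & A i x >]
  else ~~ [exists i : 'I_m, nth false a i].
pose B' (o : option 'I_r) : pred (seq bool) := fun b =>
  if o is Some i then `[< B i b >] else true.
have := @rect_cover m (option 'I_r) A' B'; rewrite card_option card_ord; apply.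
  move=> [i|] a b _ _ /=.
    move=> /asboolP[x <- Ax] /asboolP Bb; apply/eqP; rewrite -udisj_form_bits_lt.
    by apply/(AB x b).2; exists i.
  move=> /existsPn a0 _; rewrite /common big1 // => i _.
  by rewrite (negPf (a0 i)).
move=> a b _ _ ab; have [ax|ax] := boolP [exists i : 'I_m, nth false a i].
  have /AB[i Ai Bi] : udisj_form (val (exist _ a ax : I)) (bits_point b) <
      udisj_bound (val (exist _ a ax : I)) by rewrite udisj_form_bits_lt ab.
  exists (Some i); apply/andP; split; apply/asboolP => //.
  by exists (exist _ a ax).
by exists None; rewrite /= ax.
Qed.

Lemma hgraph_complexity :
  (((3 / 2) ^+ m - 1)%:E <= extension_complexity P)%E.
Proof.
apply: le_ereal_inf_tmp => _ [r /hgraph_extension h <-].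
rewrite lee_fin lerBlDr natr1 expr_div_n ler_pdivrMr ?exprn_gt0 //.
by rewrite -!natrX -natrM ler_nat.
Qed.

End LowerBound.

(** * Growth estimates *)

Section Growth.
Variable R : realType.

(* With [t = (2c+1)q] the exponential [2^t] is the [(2c+1)]-st power of
   [2^q > q], while the polynomial is of degree [2c] in [q]. *)
Lemma exp_beats_poly (K : R) (c q : nat) : 0 <= K -> (0 < q)%N ->
  1 + K * (2 * c).+1%:R ^+ (2 * c) < q%:R ->
  1 + K * ((2 * c).+1 * q)%:R ^+ (2 * c) < 2 ^+ ((2 * c).+1 * q).
Proof.
move=> K0 q0 Kq; set d := (2 * c)%N in Kq *.
have q1 : 1 <= q%:R :> R by rewrite ler1n.
have q2 : q%:R <= 2 ^+ q :> R by rewrite -natrX ler_nat ltnW // ltn_expl.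
apply: (@lt_le_trans _ _ (q%:R ^+ d.+1)); last first.
  by rewrite mulnC exprM lerXn2r // nnegrE ?exprn_ge0.
apply: (@le_lt_trans _ _ ((1 + K * d.+1%:R ^+ d) * q%:R ^+ d)).
  by rewrite mulrDl mul1r natrM exprMn mulrA lerD2r exprn_ege1.
by rewrite exprS ltr_pM2r // exprn_gt0 // (lt_le_trans ltr01).
Qed.

Lemma powR_exp2_le (k t : nat) (e : R) : (k.+1 <= 16 * t)%N -> `|e| <= 16^-1 ->
  ((2 ^ k.+1)%N)%:R `^ e <= 2 ^+ t :> R.
Proof.
move=> kt /(le_trans (ler_norm e)) e16.
apply: (@le_trans _ _ ((2 ^ k.+1)%:R `^ 16^-1)).
  by apply: ler_powR e16; rewrite ler1n expn_gt0.
rewrite natrX -powR_mulrn // -powRrM -powR_mulrn //.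
apply: ler_powR; first by rewrite ler1n.
by rewrite ler_pdivrMr // -natrM ler_nat mulnC.
Qed.

End Growth.

(** * Choice of parameters and contradiction *)

Theorem theorem6p5 (R : realType) :
  ETH ->
  ~ (forall (Pi : vertex_subset_problem) (D : dp_core)
            (alpha : nat -> nat -> nat),
       solution_preserving D Pi -> table_complexity D alpha ->
       dp_solves D Pi ->
       exists (eps : nat -> nat -> R) (C : R) (c : nat),
         (eps p.1 p.2 @[p --> (\oo, \oo)] --> (0 : R)) /\
         forall (G : graph) (k n : nat),
           #|` gV G| = n -> treewidth G k ->
           (extension_complexity (@solution_polytope R Pi G) <=
              (C * (alpha k n)%:R `^ eps k n * n%:R ^+ c)%:E)%E).
Proof.
move=> _ /(_ _ _ _ indset_preserving indset_table indset_solves).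
move=> [eps [C [c [eps0 bound]]]].
(* The exponent 1/16 suffices, because later $k + 1 \le 3m + 1 = 12t + 1 \le 16t$. *)
have [K0 [N0 epsle]] : exists K0 N0, forall k n, (K0 <= k)%N -> (N0 <= n)%N ->
    `|eps k n| <= 16^-1.
  have : \forall p \near (\oo, \oo), `|eps p.1 p.2| <= 16^-1.
    by apply: (cvgr0_norm_le _ eps0); rewrite invr_gt0.
  case=> -[A B] /= [[K0 _ hA] [N0 _ hB]] AB.
  exists K0, N0 => k n Kk Nn; apply: (AB (k, n)).
  by split; [apply: hA|apply: hB].
(* The factor $64^c$ absorbs $n^c$, as $n = 16t^2 + 12t \le 64t^2$. *)
pose K := `|C| * 64 ^+ c.
have K_ge0 : 0 <= K by rewrite mulr_ge0 // exprn_ge0.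
pose L := 1 + K * (2 * c).+1%:R ^+ (2 * c).
pose q := (Num.bound L + K0 + N0).+1.
have Lq : L < q%:R.
  apply: lt_le_trans (archi_boundP _) _.
    by rewrite addr_ge0 // mulr_ge0 // exprn_ge0.
  by rewrite ler_nat /q; lia.
have q_gt0 : (0 < q)%N by [].
(* With $m = 4t$, $(3/2)^m = (81/16)^t \ge 4^t$: one factor $2^t$ beats the table term, the other
   the polynomial. *)
pose t := ((2 * c).+1 * q)%N; pose m := (4 * t)%N.
have qt : (q <= t)%N by rewrite leq_pmull.
have t_gt0 : (0 < t)%N := leq_trans q_gt0 qt.
have m_gt0 : (0 < m)%N by rewrite muln_gt0.
have [k [twk mk km]] := hgraph_treewidth m_gt0.
have := le_trans (hgraph_complexity R m) (bound _ _ _ (card_hgraph m) twk).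
rewrite lee_fin; apply/negP; rewrite -ltNge.
have e16 : `|eps k (m ^ 2 + 3 * m)%N| <= 16^-1.
  by apply: epsle; move: mk qt; rewrite /m /q; nia.
have n_le : (m ^ 2 + 3 * m)%:R ^+ c <= 64 ^+ c * t%:R ^+ (2 * c) :> R.
  rewrite exprM -exprMn -[t%:R ^+ 2]natrX -natrM.
  by apply: lerXn2r; rewrite ?nnegrE ?ler0n // ler_nat /m; nia.
apply: (@le_lt_trans _ _ (K * t%:R ^+ (2 * c) * 2 ^+ t)).
  apply: (@le_trans _ _ (`|C| * 2 ^+ t * (64 ^+ c * t%:R ^+ (2 * c)))).
    set p := _ `^ _; have p_ge0 : 0 <= p by apply: powR_ge0.
    apply: (@le_trans _ _ (`|C| * p * (m ^ 2 + 3 * m)%:R ^+ c)).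
      by rewrite !ler_wpM2r // ?exprn_ge0 // ler_norm.
    apply: ler_pM => //; first exact: mulr_ge0.
    apply: ler_wpM2l => //; apply: powR_exp2_le e16.
    by move: km t_gt0; rewrite /m; lia.
  by rewrite /K le_eqVlt; apply/orP; left; apply/eqP; ring.
(* Multiplication by $2^t$ gives $K t^{2c} 2^t < 4^t - 2^t \le (3/2)^m - 1$. *)
have : 1 + K * t%:R ^+ (2 * c) < 2 ^+ t by apply: exp_beats_poly.
have : 1 <= 2 ^+ t :> R by rewrite exprn_ege1 // ler1n.
have : 2 ^+ t * 2 ^+ t <= (3 / 2) ^+ m :> R.
  rewrite -exprMn /m exprM lerXn2r ?nnegrE //; lra.
nra.
Qed.
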